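(* Let $s,K,R_1,R_2\ge 1$ be integers. Then the number $v_{K;R_1,R_2}^{(s)}$ of proper vertical arrays is $$v_{K;R_1,R_2}^{(s)}=\frac{(s+R_1-1)!\,(s+R_2-1)!}{(s+R_1+R_2-2)!}\binom{s+R_1+R_2-2}{K-1}\left[\binom{K-1}{R_1-1}\binom{K-1}{R_2-1}-\binom{K-1}{s+R_1-1}\binom{K-1}{s+R_2-1}\right].$$
   Context: Vertical arrays. Let $\mathcal K=\{1,\dots,K\}$ be the set of columns. A vertical array with parameters $K,R_1,R_2,s$ consists of: a $2\times K$ array of cells (cell $(i,j)$ is in row $i\in\{1,2\}$, column $j\in\mathcal K$), where each cell contains a (possibly empty) list of vertices ordered from left to right, each row containing exactly $s$ vertices in total; a perfect matching of the $2s$ vertices in which every pair consists of one vertex in row 1 and one vertex in row 2; and, for each $i=1,2$, a set $\mathcal R_i\subseteq\mathcal K$ of exactly $R_i$ columns, whose cells in row $i$ are called marked (by a box). (There are no such arrays if $R_i>K$.) Vertices carry no labels: two arrays are equal if they have the same number of vertices in each cell, the same marked cells, and the same matching of vertex positions. A vertical array is proper if it satisfies the following three conditions. - Non-empty condition: each column contains at least one object, i.e. a vertex or a box (mark) in at least one of its two cells. - Balance condition: for each column $j$, cells $(1,j)$ and $(2,j)$ contain the same number of vertices. - Forest condition: for $i=1,2$ let $\mathcal F_i$ be the set of columns with at least one vertex in row $i$, and define $\psi_i:\mathcal F_i\setminus\mathcal R_i\to\mathcal K$ by letting $\psi_i(j)$ be the column containing the vertex that is paired with the rightmost vertex of cell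 $(i,j)$. The condition is that for each $i=1,2$ and each $j\in\mathcal F_i\setminus\mathcal R_i$ there is a positive integer $t$ with $\psi_i^t(j)\in\mathcal R_i$ (equivalently, the functional digraph of $\psi_i$ is a forest with root set $\mathcal R_i$). $v_{K;R_1,R_2}^{(s)}$ denotes the number of proper vertical arrays with these parameters. Binomial coefficients $\binom nk$ of non-negative integers are $0$ when $k>n$. *)

(* Defs.v *)
From HB Require Import structures.
From mathcomp Require Import all_boot all_order all_algebra all_fingroup.

Set Implicit Arguments.
Unset Strict Implicit.
Unset Printing Implicit Defensive.

(* Rows are indexed by [bool]: [false] is row 1 and [true] is row 2, so that   *)
(* [~~ i] is the row opposite to [i].                                          *)
(* The vertices of a row, read from left to right across all its cells, are    *)
(* numbered 0, ..., s - 1. A datum ((c, M), m) gives the column [c i v] of     *)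
(* vertex [v] of row [i], the set [M i] of columns marked in row [i], and the  *)
(* matching pairing vertex [v] of row 1 with vertex [m v] of row 2.            *)
Definition varray_data (K s : nat) : Type :=
  ({ffun bool -> {ffun 'I_s -> 'I_K}} * {ffun bool -> {set 'I_K}} * 'S_s)%type.

(* Column functions are weakly increasing because the numbering is from left   *)
(* to right; such a function amounts to the number of vertices in each cell of *)
(* the row, so equality of data is equality of unlabelled arrays.              *)
Definition varray_wf (K R1 R2 s : nat) (A : varray_data K s) : bool :=
  [&& [forall i, forall u : 'I_s, forall v : 'I_s,
         (u <= v) ==> (A.1.1 i u <= A.1.1 i v)],
      #|A.1.2 false| == R1 & #|A.1.2 true| == R2].

Record varray (K R1 R2 s : nat) : Type :=
  VArray { vdata : varray_data K s; _ : varray_wf R1 R2 vdata }.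

HB.instance Definition _ (K R1 R2 s : nat) :=
  [isSub for @vdata K R1 R2 s].
HB.instance Definition _ (K R1 R2 s : nat) :=
  [Finite of varray K R1 R2 s by <:].

Section VerticalArrays.

Variables (K R1 R2 s : nat).
Implicit Types (A : varray K R1 R2 s) (i : bool) (j k : 'I_K) (v : 'I_s).

Definition vcol A i v : 'I_K := (vdata A).1.1 i v.

Definition marked A i : {set 'I_K} := (vdata A).1.2 i.

Definition partner A i v : 'I_s :=
  let m := (vdata A).2 in if i then (m^-1)%g v else m v.

Definition cell A i j : seq 'I_s := [seq v <- enum 'I_s | vcol A i v == j].

Definition nonempty_condition A : bool :=
  [forall j, [exists i, (cell A i j != [::]) || (j \in marked A i)]].

Definition balance_condition A : bool :=
  [forall j, size (cell A false j) == size (cell A true j)].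

Definition occupied A i : {set 'I_K} := [set j | cell A i j != [::]].

(* The partial function psi_i, equal to [None] off its domain F_i \ R_i.       *)
Definition psi A i j : option 'I_K :=
  if j \in marked A i then None
  else if cell A i j is v :: c
       then Some (vcol A (~~ i) (partner A i (last v c)))
       else None.

Definition psi_iter A i (t : nat) j : option 'I_K :=
  iter t (obind (psi A i)) (Some j).

Definition forest_condition A : Prop :=
  forall i j, j \in occupied A i :\: marked A i ->
  exists t : nat, 0 < t /\ exists2 r, r \in marked A i & psi_iter A i t j = Some r.

Definition proper A : Prop :=
  [/\ nonempty_condition A, balance_condition A & forest_condition A].

(* Decision procedures, needed to count proper arrays.                         *)
Definition forestb A : bool :=
  [forall i, forall j in occupied A i :\: marked A i,
     [exists r in marked A i, connect [rel k l | psi A i k == Some l] j r]].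

Definition properb A : bool :=
  [&& nonempty_condition A, balance_condition A & forestb A].

Lemma connect_psiP A i j k :
  reflect (exists t, psi_iter A i t j = Some k)
          (connect [rel l l' | psi A i l == Some l'] j k).
Proof.
apply: (iffP idP) => [/connectP[p ep ->]|[t]].
  exists (size p); elim: p j ep => //= l p IHp j /andP[/eqP e_jl /IHp].
  by rewrite /psi_iter -iterS iterSr /= e_jl.
elim: t k => [|t IHt] k; first by case=> ->; apply: connect0.
rewrite /psi_iter iterS -/(psi_iter A i t j).
case: (psi_iter A i t j) IHt => //= l IHt e_lk.
by apply: connect_trans (IHt l erefl) (connect1 _); apply/eqP.
Qed.

Lemma forestP A : reflect (forest_condition A) (forestb A).
Proof.
apply: (iffP forallP) => [fA i j jD|fA i].
  have /exists_inP[r rR /connect_psiP[t tr]] := forall_inP (fA i) j jD.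
  exists t; split; last by exists r.
  case: t tr => // -[e_jr]; move: jD.
  by rewrite inE e_jr rR.
apply/forall_inP => j /fA[t [_ [r rR tr]]].
by apply/exists_inP; exists r => //; apply/connect_psiP; exists t.
Qed.

Lemma properP A : reflect (proper A) (properb A).
Proof.
apply: (iffP and3P) => -[neA baA foA]; split=> //; exact/forestP.
Qed.

End VerticalArrays.

Definition num_proper (K R1 R2 s : nat) : nat :=
  #|[set A : varray K R1 R2 s | properb A]|.

(* Main.v *)
Require Import Defs.
From mathcomp Require Import all_boot all_order all_algebra all_fingroup.
From mathcomp Require Import ring lra zify.
Import GRing.Theory Num.Theory.

(** Balance and the left-to-right numbering force both rows of a proper array to
    have the same weakly increasing column function c. An array is therefore
    given by c, two sets of marks R1 and R2, and a matching m; c amounts to the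
    composition of s that lists the numbers of vertices of the columns. If a j
    denotes the last vertex of an occupied column j, then psi_1 j = c (m (a j))
    and psi_2 j = c (m^-1 (a j)), and the forest condition says that psi_i has no
    cycle off R_i.

    Signs. For a map f and a set A, the sum of (-1)^|S| times the sign of f on S,
    over the subsets S of A that f permutes, is the determinant of the identity
    minus f on A; it is 1 if f has no cycle in A and 0 otherwise
    ([signed_forest_sum]). Expanding both forest conditions in this way gives a
    signed count of matchings m together with permutations u1 of S1 and u2 of S2
    induced by psi_1 and psi_2. A column of S1 is loose if the partner of its last
    vertex is not the last vertex of a column of S2. Exchanging the partners of
    two loose last vertices multiplies u1 by a transposition and changes nothing
    else, so everything cancels except the configurations with at most one loose
    column in each row ([signed_sum_tame]). In these u2 is the inverse of u1 and
    S1, S2 differ by at most one column in each direction; their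
    numbers are products of factorials and of at most two column sizes, or sums
    of such products
    ([signed_sum_same], [signed_sum_one], [signed_sum_two]).

    Summation. The resulting expressions have degree at most 2 in the composition,
    so their sums over compositions are coefficients of series z^e / (1 - z)^w
    ([comp_moment2]). Only the sizes of the sets enter, and the terms of
    neighbouring sizes combine ([level_pair]): the arrays whose vertices and marks
    lie in k given columns number
      sum over n < k <= n + s of (s + n)! / n! * C(n, R1 - 1) * C(n, R2 - 1)
    ([within_sumE], [within_countE]).

    Non-empty columns. Sorting arrays by the set of columns that contain an object
    expresses this number as the sum over j of C(k, j) times the number of proper
    arrays with j columns, and these relations for all k determine the latter.
    The stated formula satisfies them ([sum_support_formula]): raising k by one adds
    the term n = k and drops the term n = k - s, and Vandermonde's convolution
    produces the first from one product of binomials in the bracket and the second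
    from the other. *)

Set Implicit Arguments.
Unset Strict Implicit.
Unset Printing Implicit Defensive.

Local Open Scope ring_scope.

(** * Coefficients of negative binomial series and sums over compositions *)

(** The coefficient of z^n in z^e / (1 - z)^w. *)
Fixpoint negbin_coef (e w n : nat) : nat :=
  match e, n with
  | 0, _ => 'C((n + w).-1, n)
  | e'.+1, 0 => 0
  | e'.+1, n'.+1 => negbin_coef e' w n'
  end.
Arguments negbin_coef : simpl nomatch.

Lemma negbin_coefE e w n : negbin_coef e w n = if (e <= n)%N then 'C((n - e + w).-1, n - e) else 0%N.
Proof. by elim: e n => [|e IH] [|n] //=; rewrite subn0. Qed.

Lemma negbin_coef_n0 e w : negbin_coef e w 0 = (e == 0)%N.
Proof. by case: e => //=; rewrite bin0. Qed.

(** Pascal's rule is the identity 1 / (1 - z)^(w+1) = 1 / (1 - z)^w + z / (1 -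
    z)^(w+1) read on coefficients, which reduces both w and n. *)
Lemma negbin_conv0 w w' n :
  (\sum_(i < n.+1) negbin_coef 0 w i * negbin_coef 0 w' (n - i) = negbin_coef 0 (w + w') n)%N.
Proof.
elim: w n => [|w IHw] n.
  rewrite big_ord_recl big1 => [|i _]; first by rewrite negbin_coef_n0 mul1n subn0 addn0.
  by rewrite /= addn0 bin_small.
elim: n => [|n IHn]; first by rewrite big_ord1 !negbin_coef_n0.
rewrite big_ord_recl subn0.
transitivity (negbin_coef 0 (w + w') n.+1 + negbin_coef 0 (w.+1 + w') n)%N; last first.
  by rewrite /= !addSn !addnS /= binS.
rewrite -IHw -IHn [in RHS]big_ord_recl subn0 /= -!addnA -big_split /= !bin0.
congr addn; apply: eq_bigr => i _.
by rewrite /bump /= !add1n subSS -mulnDl !add0n addnS /= binS.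
Qed.

Lemma negbin_conv e w e' w' n :
  (\sum_(i < n.+1) negbin_coef e w i * negbin_coef e' w' (n - i) = negbin_coef (e + e') (w + w') n)%N.
Proof.
elim: e n => [|e IHe] n; last first.
  rewrite big_ord_recl negbin_coef_n0 mul0n add0n; case: n => [|n]; first by rewrite big_ord0.
  by rewrite addSn /= -IHe; apply: eq_bigr.
rewrite add0n; elim: e' n => [|e' IHe'] n; first exact: negbin_conv0.
rewrite big_ord_recr /= subnn muln0 addn0.
case: n => [|n]; first by rewrite big_ord0.
by rewrite /= -IHe'; apply: eq_bigr => i _; rewrite subSn // -ltnS.
Qed.

(** Truncate each series to a polynomial of degree s: the sum over p is then a
    coefficient of the product of these polynomials, and up to degree s the
    truncations multiply like the series. *)
Lemma sum_compositions (I : finType) (s t : nat) (e w : I -> nat) : (t <= s)%N ->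
  (\sum_(p : {ffun I -> 'I_s.+1} | \sum_i p i == t) \prod_i negbin_coef (e i) (w i) (p i)
   = negbin_coef (\sum_i e i) (\sum_i w i) t)%N.
Proof.
move=> ts.
pose f i : {poly int} := \sum_(j < s.+1) (negbin_coef (e i) (w i) j)%:Z *: 'X^j.
have E0 : (\prod_i f i)`_t = (\sum_(p : {ffun I -> 'I_s.+1} | \sum_i p i == t)
    \prod_i negbin_coef (e i) (w i) (p i))%N%:Z.
  rewrite /f bigA_distr_bigA coef_sum /= [RHS](big_morph Posz PoszD (erefl _)).
  rewrite [RHS]big_mkcond; apply: eq_bigr => p _.
  rewrite scaler_prod prodrXr coefZ coefXn eq_sym.
  case: eqP => _; rewrite ?mulr0 // mulr1.
  by rewrite (big_morph Posz PoszM (erefl _)).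
apply/eqP; rewrite -eqz_nat -E0; apply/eqP.
elim/big_rec3: _ t ts {E0} => [|i a b q _ IH] t ts.
  by rewrite coef1; case: t {ts} => [|t] //=; rewrite addn0 bin_small.
rewrite coefM -negbin_conv [RHS](big_morph Posz PoszD (erefl _)).
apply: eq_bigr => j _; rewrite PoszM IH; last by apply: leq_trans ts; apply: leq_subr.
congr (_ * _); rewrite /f coef_sum.
have js : (j < s.+1)%N by apply: leq_trans (ltn_ord j) _.
rewrite (bigD1 (Ordinal js)) //= coefZ coefXn eqxx mulr1 big1 ?addr0 // => k nk.
rewrite coefZ coefXn; case: eqP => [E|_]; last by rewrite mulr0.
by case/eqP: nk; apply: val_inj; rewrite /= E.
Qed.

(** Compositions of s with support in T and positive entries on S. Entries are
    at most s, hence the finite codomain. *)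
Definition comp_on (I : finType) (s : nat) (S T : {set I}) (p : {ffun I -> 'I_s.+1}) :=
  (\sum_i p i == s)%N && [forall i, ((i \in S) ==> (0 < p i)%N) && ((i \notin T) ==> (p i == 0 :> nat))].

(** This makes binomial moments of compositions, with a lower bound e on an
    entry, instances of [sum_compositions]. *)
Lemma negbin_coef_bin e d n : negbin_coef (e + d) d.+1 n = ((e <= n) * 'C(n - e, d))%N.
Proof.
rewrite negbin_coefE subnDA addnS /=; case: leqP => h.
  rewrite (leq_trans (leq_addr d e) h) mul1n subnK ?leq_subRL ?(leq_trans (leq_addr d e)) //.
  by rewrite bin_sub // leq_subRL // (leq_trans (leq_addr d e)).
case: leqP => //= en; rewrite bin_small //; lia.
Qed.

Section Moments.
Variables (I : finType) (s : nat) (S T : {set I}).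
Hypothesis ST : S \subset T.

Lemma comp_bin_moment (d : I -> nat) : (forall i, i \notin T -> d i = 0%N) ->
  (\sum_(p : {ffun I -> 'I_s.+1} | comp_on S T p) \prod_(i in T) 'C(p i - (i \in S), d i)
   = negbin_coef (#|S| + \sum_i d i) (#|T| + \sum_i d i) s)%N.
Proof.
move=> dT.
have -> : (#|S| + \sum_i d i = \sum_i ((i \in S) + d i))%N.
  by rewrite big_split /= -sum1_card big_mkcond; congr addn; apply: eq_bigr => i _; case: (i \in S).
have -> : (#|T| + \sum_i d i = \sum_i ((i \in T) + d i))%N.
  by rewrite big_split /= -sum1_card big_mkcond; congr addn; apply: eq_bigr => i _; case: (i \in T).
rewrite -(@sum_compositions I s) // [LHS]big_mkcond [RHS]big_mkcond; apply: eq_bigr => p _.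
rewrite /comp_on; case: eqP => //= _; case: ifP => [/forallP H|/negbT].
  rewrite big_mkcond; apply: eq_bigr => i _; have /andP[hS hT] := H i.
  case: ifPn hT => [iT _|iT /eqP pi0].
    by rewrite add1n negbin_coef_bin; case: (i \in S) hS => /= [->|_]; rewrite mul1n.
  by rewrite (contraNF (subsetP ST i) iT) dT // pi0.
rewrite negb_forall => /existsP[i]; rewrite negb_and !negb_imply => H.
rewrite (bigD1 i) //=; case/orP: H => /andP[iST pi].
  by rewrite iST (subsetP ST _ iST) (add1n (d i)) -[X in negbin_coef X](add1n (d i)) negbin_coef_bin (negbTE pi).
rewrite (negbTE iST) (contraNF (subsetP ST i) iST) dT //= addn0.
by rewrite addn0 bin_small ?mul0n // prednK ?lt0n.
Qed.

Local Notation u p i := (p i - (i \in S))%N.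

Lemma comp_moment0 : (\sum_(p : {ffun I -> 'I_s.+1} | comp_on S T p) 1 = negbin_coef #|S| #|T| s)%N.
Proof.
have := @comp_bin_moment (fun=> 0%N) (fun _ _ => erefl).
rewrite big1_eq !addn0 => <-; apply: eq_bigr => p _.
by rewrite big1 // => i _; rewrite bin0.
Qed.

Lemma sum_eq1 (x : I) : (\sum_i (i == x) = 1)%N.
Proof. by rewrite (bigD1 x) //= eqxx big1 // => i /negbTE->. Qed.

Lemma comp_moment1 x : x \in T ->
  (\sum_(p : {ffun I -> 'I_s.+1} | comp_on S T p) u p x = negbin_coef #|S|.+1 #|T|.+1 s)%N.
Proof.
move=> xT; have dT i : i \notin T -> (i == x : nat) = 0%N by case: eqP => // ->; rewrite xT.
have := comp_bin_moment dT; rewrite sum_eq1 !addn1 => <-.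
apply: eq_bigr => p _; rewrite (bigD1 x) //= eqxx bin1 big1 ?muln1 // => i /andP[_ /negbTE->].
exact: bin0.
Qed.

(** For x = z, the square of u is twice 'C(u, 2) plus u, which explains the
    two corrections. *)
Lemma comp_moment2 x z : x \in T -> z \in T ->
  (\sum_(p : {ffun I -> 'I_s.+1} | comp_on S T p) u p x * u p z =
   (1 + (x == z)) * negbin_coef #|S|.+2 #|T|.+2 s + (x == z) * negbin_coef #|S|.+1 #|T|.+1 s)%N.
Proof.
move=> xT zT; have dT i : i \notin T -> ((i == x) + (i == z) = 0)%N.
  by case: eqP => [->|_]; rewrite ?xT //; case: eqP => // ->; rewrite zT.
have := comp_bin_moment dT; rewrite big_split /= !sum_eq1 -[(1 + 1)%N]/2%N !addn2 => <-.
rewrite -(comp_moment1 xT) !big_distrr -big_split /=; apply: eq_bigr => p _.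
rewrite (bigD1 x) //= eqxx; case: (eqVneq x z) => [<-|xz].
  rewrite big1 => [|i /andP[_ /negbTE->]]; last exact: bin0.
  rewrite muln1 mul1n -[(1 + true)%N]/2%N mul2n.
  by case: (u p x) => // n; rewrite bin2 -[RHS]addnC /= mulSn; move: (odd_double_half (n.+1 * n)); rewrite oddM /= andNb; lia.
rewrite (bigD1 z) ?zT /=; last by rewrite eq_sym xz.
rewrite eqxx eq_sym (negbTE xz) big1 => [|i /andP[/andP[_ /negbTE->] /negbTE->]]; last exact: bin0.
by rewrite !bin1 mul0n addn0 mul1n muln1.
Qed.
End Moments.

(** * Closed forms, telescoping and the Vandermonde convolution *)

Lemma negbin_coef_fact e w n : (e <= n)%N ->
  ((n - e)`! * negbin_coef e w.+1 n * w`! = (n - e + w)`!)%N.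
Proof.
move=> en; rewrite negbin_coefE en addnS /= -(bin_fact (leq_addr w (n - e))) addKn; ring.
Qed.

(** The falling factorial counts the distributions of s distinct objects into
    k - h ordered lists. The level h comes from h columns together with one
    more vertex, whence the cut-off at h = s. *)
Definition level (s k h : nat) : nat :=
  if (h < k)%N && (h < s)%N then ((s + (k - h.+1)) ^_ s)%N else 0%N.

Lemma level_fact s k h : (h < k)%N -> (h < s)%N ->
  (level s k h * (k - h.+1)`! = (s + (k - h.+1))`!)%N.
Proof. by move=> hk hs; rewrite /level hk hs -(ffact_fact (leq_addr _ s)) addKn. Qed.

Lemma fact_neq0 n : n`!%:R != 0 :> rat.
Proof. by rewrite pnatr_eq0 -lt0n fact_gt0. Qed.

Lemma bin_rat n m : (m <= n)%N -> 'C(n, m)%:R = n`!%:R / (m`!%:R * (n - m)`!%:R) :> rat.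
Proof.
by move=> mn; rewrite -(bin_fact mn) !natrM mulfK // mulf_neq0 ?fact_neq0.
Qed.

Lemma level_rat s k h : (h <= k)%N -> (h < s)%N ->
  (level s k h)%:R = (k - h)%:R * (s + k - h.+1)`!%:R / (k - h)`!%:R :> rat.
Proof.
move=> hk hs; case: (ltngtP h k) hk => // [hk|->] _; last first.
  by rewrite /level ltnn subnn !mul0r.
rewrite -[(k - h)%N]subnSK // factS natrM -addnBA // -level_fact // natrM.
by field; rewrite fact_neq0 nat1r pnatr_eq0.
Qed.

Lemma negbin_coef_rat e w n : (e <= n)%N ->
  (negbin_coef e w.+1 n)%:R = (n - e + w)`!%:R / ((n - e)`!%:R * w`!%:R) :> rat.
Proof.
by move=> /negbin_coef_fact<-; rewrite !natrM; field; rewrite !fact_neq0.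
Qed.

Lemma negbin_coef_small e w n : (n < e)%N -> negbin_coef e w n = 0%N.
Proof. by move=> ne; rewrite negbin_coefE leqNgt ne. Qed.

Lemma negbin_coef_ratS e w n : (e <= n)%N ->
  (negbin_coef e.+1 w.+2 n)%:R
    = (n - e)%:R * (n - e + w)`!%:R / ((n - e)`!%:R * w.+1`!%:R) :> rat.
Proof.
rewrite leq_eqVlt => /orP[/eqP->|en]; first by rewrite negbin_coef_small // subnn !mul0r.
rewrite negbin_coef_rat // -[(n - e)%N]subnSK // (factS (n - _)) natrM addSnnS.
by field; rewrite !fact_neq0 nat1r pnatr_eq0.
Qed.

Lemma negbin_coef_diag e w : negbin_coef e w e = 1%N.
Proof. by rewrite negbin_coefE leqnn subnn bin0. Qed.

(** The contribution of the pairs of sets of sizes h + 1 and h. *)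
Lemma level_single s k h : (h <= k)%N ->
  ('C(k, h) * (k - h) * (h`! * (s - h.+1)`! * negbin_coef h.+1 k.+1 s) = level s k h)%N.
Proof.
move=> hk; have [hs|hs] := ltnP h s; last first.
  by rewrite /level (ltnNge h s) hs andbF negbin_coefE leqNgt ltnS hs !muln0.
apply/eqP; rewrite -(eqr_nat rat) level_rat // !natrM bin_rat // negbin_coef_rat //.
have -> : (s - h.+1 + k = s + k - h.+1)%N by lia.
by apply/eqP; field; rewrite !fact_neq0.
Qed.

(** Pairs of sets of equal size h have three sources: one set of h columns all
    of whose last vertices are matched together, the same with a loose column
    in each row, and two distinct sets with h - 1 common columns. That their
    contributions add up to two adjacent levels is what makes the sum over h
    collapse. *)
Lemma level_pair s k h : (h <= k)%N -> (0 < s)%N ->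
  ('C(k, h) * (h`! * (s - h)`! * negbin_coef h k s +
       h.-1`! * (s - h.+1)`! * (h * h.+1 * negbin_coef h.+2 k.+2 s + h * negbin_coef h.+1 k.+1 s))
   + (if h is h'.+1 then 'C(k, h') * ((k - h') * (k - h'.+1)) *
         (h'`! * (s - h'.+2)`! * negbin_coef h'.+2 k.+2 s) else 0)
   = level s k h + (if h is h'.+1 then level s k h' else 0))%N.
Proof.
move=> hk s0; case: h hk => [|h] hk.
  rewrite bin0 !mul0n muln0 !addn0 !mul1n subn0.
  case: k hk => [|k] _; first by rewrite /= addn0 bin_small ?muln0 // prednK.
  apply/eqP; rewrite -(eqr_nat rat) level_rat // !subn0 factS !natrM negbin_coef_rat // !subn0.
  have -> : (s + k.+1 - 1 = s + k)%N by lia.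
  by apply/eqP; field; rewrite !fact_neq0 nat1r pnatr_eq0.
have [hs|sh] := ltnP h s; last first.
  rewrite /level ![(_ < s)%N]ltnNge (leqW sh) sh !andbF.
  by rewrite !negbin_coef_small ?muln0 // ?ltnS // !leqW.
have EB : (level s k h)%:R = (s + k - h.+1)`!%:R / (k - h.+1)`!%:R :> rat.
  rewrite level_rat ?(ltnW hk) // -[in (k - h)%N]subnSK // factS natrM.
  by field; rewrite !fact_neq0 nat1r pnatr_eq0.
apply/eqP; rewrite -(eqr_nat rat) ![(_ + _)%:R]natrD EB; apply/eqP.
(* At s = h.+1 each column of the set contains a single vertex, and only the
   term without loose columns survives. *)
move: hs; rewrite leq_eqVlt => /orP[/eqP E|hs].
  rewrite -E /level ltnn andbF subnn negbin_coef_diag !(@negbin_coef_small _.+2) //.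
  rewrite !muln0 addn0 !muln1 addr0 add0r natrM bin_rat // addKn.
  by field; rewrite !fact_neq0.
case: k hk {EB} => // k hk.
rewrite level_rat // !subSS.
have Eb := bin_rat hk; have Eb' := bin_rat (leqW hk : (h <= k.+1)%N).
have E0 := negbin_coef_rat k (ltnW hs); have E1 := negbin_coef_rat k.+1 hs.
have E2 := negbin_coef_ratS k.+1 hs; have E3 := negbin_coef_rat k.+2 hs.
move: 'C(_, _) 'C(_, _) (negbin_coef _ _ _) (negbin_coef _ _ _) (negbin_coef _ _ _) (negbin_coef _ _ _) Eb Eb' E0 E1 E2 E3
  => b b' m0 m2 m1 m3.
have [t Et] : exists t, s = (t + h.+2)%N by exists (s - h.+2)%N; rewrite subnK.
have [N EN] : exists N, k = (N + h)%N by exists (k - h)%N; rewrite subnK.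
have e1 : (s - h.+1 = t.+1)%N by lia.
have e2 : (s - h.+2 = t)%N by lia.
have e3 : (k - h = N)%N by lia.
have e4 : (k.+1 - h = N.+1)%N by lia.
have e5 : (s + k.+1 - h.+2 = (t + k).+1)%N by lia.
have e6 : (s + k.+1 - h.+1 = (t + k).+2)%N by lia.
rewrite !e1 !e2 !subSS !e3 !e4 e5 e6 /= !addnS !addSn.
rewrite !factS.
move: (fact_neq0 t) (fact_neq0 h) (fact_neq0 N) (fact_neq0 k) (fact_neq0 (t + k)).
move: t`! h`! N`! k`! (t + k)`! => ft fh fN fk ftk nt nh nN nk ntk.
rewrite !(natrM, natrD, EN, =^~ natr1) => -> -> -> -> -> ->.

field.

by rewrite nt nh nN nk -natrD !natr1 !pnatr_eq0.
Qed.

Lemma sum_shift (k : nat) (F G : nat -> rat) : F k = 0 ->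
  \sum_(h < k.+1) F h * G h.+1 = \sum_(h < k.+1) (if h : nat is h'.+1 then F h' else 0) * G h.
Proof. by move=> F0; rewrite big_ord_recr big_ord_recl /= F0 !mul0r addr0 add0r. Qed.

(** The contribution of the pairs (S1, S2) whose intersection is a given set
    of h columns, summed over all compositions; w a b is the number of choices
    of marks that avoid S1 and S2 when these have sizes a and b. *)
Definition level_weight (s k h : nat) (w : nat -> nat -> nat) : rat :=
   (w h h * (h`! * (s - h)`! * negbin_coef h k s +
       h.-1`! * (s - h.+1)`! * (h * h.+1 * negbin_coef h.+2 k.+2 s + h * negbin_coef h.+1 k.+1 s)))%:R
    - ((w h.+1 h + w h h.+1) * ((k - h) * (h`! * (s - h.+1)`! * negbin_coef h.+1 k.+1 s)))%:R
    + (w h.+1 h.+1 * ((k - h) * (k - h.+1) * (h`! * (s - h.+2)`! * negbin_coef h.+2 k.+2 s)))%:R.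

(** The level h occurs with the product of the two differences of 'C(k - h,
    r.+1) and 'C(k - h.+1, r.+1), which are 'C(k - h.+1, r) by Pascal's rule.
    *)
Lemma sum_level_weight s k r1 r2 : (0 < s)%N ->
  \sum_(h < k.+1) 'C(k, h)%:R * level_weight s k h (fun a b => ('C(k - a, r1.+1) * 'C(k - b, r2.+1))%N)
  = (\sum_(h < k) level s k h * ('C(k - h.+1, r1) * 'C(k - h.+1, r2)))%N%:R.
Proof.
move=> s0; pose w a b := ('C(k - a, r1.+1) * 'C(k - b, r2.+1))%N.
pose Dh h := ('C(k, h) * ((k - h) * (k - h.+1)) * (h`! * (s - h.+2)`! * negbin_coef h.+2 k.+2 s))%N.
pose pre (F : nat -> nat) h := if h is h'.+1 then F h' else 0%N.
transitivity (\sum_(h < k.+1) ((w h h)%:R * ((level s k h)%:R + (pre (level s k) h)%:R - (pre Dh h)%:R)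
   - ((w h.+1 h)%:R + (w h h.+1)%:R) * (level s k h)%:R + (Dh h)%:R * (w h.+1 h.+1)%:R : rat)).
  apply: eq_bigr => h _; have hk : (h <= k)%N by rewrite -ltnS.
  have E := level_pair hk s0; rewrite -[X in (_ + X)%N]/(pre Dh h) -[X in _ = (_ + X)%N]/(pre (level s k) h) in E.
  rewrite -!natrD -E natrD addrK -(level_single s hk) /level_weight -/(w h h) -/(w h.+1 h) -/(w h h.+1) -/(w h.+1 h.+1) /Dh.
  move: (w _ _) (w _ _) (w _ _) (w _ _) 'C(k, h) (k - h)%N (k - h.+1)%N => a b c d e f g.
  set u := (_ + _)%N; set v := (_ * _)%N; set y := (_ * _ * _)%N.
  by rewrite !(natrM, natrD); ring.
rewrite big_split /= (sum_shift (F := fun h => (Dh h)%:R) (fun h => (w h h)%:R)); last first.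
  by rewrite /Dh subnn !(mul0n, muln0).
have lvlk : (level s k k)%:R = 0 :> rat by rewrite /level ltnn.
transitivity (\sum_(h < k.+1) (level s k h)%:R * ((w h h)%:R - (w h.+1 h)%:R - (w h h.+1)%:R)
    + \sum_(h < k.+1) (level s k h)%:R * (w h.+1 h.+1)%:R : rat).
  rewrite (sum_shift (F := fun h => (level s k h)%:R) (fun h => (w h h)%:R)) //.
  rewrite -!big_split /=; apply: eq_bigr => -[[|h] hk] _ /=; ring.
rewrite -big_split big_ord_recr /= lvlk !mul0r !addr0 natr_sum; apply: eq_bigr => h _.
rewrite natrM -mulrDr /w; congr (_ * _).
have -> : (k - h = (k - h.+1).+1)%N by rewrite subnSK.
by rewrite !binS !(natrM, natrD); ring.
Qed.

Definition level_product (s r1 r2 n : nat) : nat := ((s + n) ^_ s * ('C(n, r1) * 'C(n, r2)))%N.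

(** The number of arrays with r1.+1 and r2.+1 marks that satisfy the balance
    and forest conditions and whose vertices and marks lie in k given columns,
    some of which may be empty. *)
Definition within_count (s r1 r2 k : nat) : nat :=
  (\sum_(h < k) level s k h * ('C(k - h.+1, r1) * 'C(k - h.+1, r2)))%N.

(** Substituting n = k - h - 1 shows a window of at most s consecutive
    terms. *)
Lemma within_countE s r1 r2 k :
  within_count s r1 r2 k = (\sum_(n < k | k <= n + s) level_product s r1 r2 n)%N.
Proof.
rewrite /within_count [RHS](reindex_inj rev_ord_inj) /= [RHS]big_mkcond /=; apply: eq_bigr => h _.
rewrite /level ltn_ord /= /level_product.
have -> : (k <= k - h.+1 + s)%N = (h < s)%N by have := ltn_ord h; lia.
by case: ifP.
Qed.

(** Raising k by one shifts the window of [within_countE] by one. *)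
Lemma within_countS s r1 r2 k : (0 < s)%N ->
  (within_count s r1 r2 k.+1 + (if s <= k then level_product s r1 r2 (k - s) else 0)
   = within_count s r1 r2 k + level_product s r1 r2 k)%N.
Proof.
move=> s0; rewrite !within_countE big_mkcond big_ord_recr /= addnC addnA.
have -> : (k < k + s)%N by lia.
congr addn; rewrite -big_mkcond /=.
case: leqP => sk.
  have lt : (k - s < k)%N by lia.
  rewrite [RHS](bigD1 (Ordinal lt)) /= ?subnK //; congr addn; apply: eq_bigl => n.
  by rewrite -val_eqE /=; lia.
by apply: eq_bigl => n; lia.
Qed.

Lemma bin_mul_bin m j b : (b <= j)%N -> ('C(m, j) * 'C(j, b) = 'C(m, b) * 'C(m - b, j - b))%N.
Proof.
move=> bj; case: (leqP j m) => [jm|mj]; last first.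
  rewrite (bin_small mj); case: (ltnP m b) => mb; first by rewrite (bin_small mb).
  by rewrite ['C(m - b, _)]bin_small ?muln0 // ltn_sub2r // (leq_ltn_trans mb).
have bm := leq_trans bj jm; apply/eqP; rewrite -(eqr_nat rat) !natrM !bin_rat ?leq_sub2r //.
by rewrite subnBA // subnK //; apply/eqP; field; rewrite !fact_neq0.
Qed.

(** By [bin_mul_bin] the summand is a constant times 'C(L - a, L - j) * 'C(n -
    b, j - b), to which Vandermonde's convolution applies. *)
Lemma sum_four_bin L n a b : (b <= n)%N -> (b <= L)%N -> (a <= L)%N ->
  (\sum_(j < L.+1) 'C(L, j) * ('C(n, j) * ('C(j, a) * 'C(j, b)))
   = 'C(L, a) * 'C(n, b) * 'C(L - a + (n - b), L - b))%N.
Proof.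
move=> bn bL aL; rewrite -binomial.Vandermonde big_distrr /=.
have lt : ((L - b).+1 <= L.+1)%N by rewrite ltnS leq_subr.
rewrite (big_ord_widen_cond _ predT (fun j => 'C(L, a) * 'C(n, b) * ('C(L - a, j) * 'C(n - b, L - b - j)))%N lt).
rewrite (reindex_inj rev_ord_inj) /= [RHS]big_mkcond; apply: eq_bigr => i _.
rewrite subSS ltnS; have iL : (i <= L)%N by rewrite -ltnS.
case: leqP => ib; last by rewrite ['C(L - i, b)]bin_small ?muln0 //; lia.
case: (leqP a (L - i)) => ia; last first.
  by rewrite ['C(L - i, a)]bin_small ?['C(L - a, i)]bin_small ?muln0 ?mul0n ?muln0 //; lia.
rewrite mulnA mulnACA bin_mul_bin // bin_mul_bin; last by lia.
rewrite [(L - i - b)%N]subnAC [RHS]mulnACA; congr (_ * _ * _)%N.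
rewrite -['C(L - a, i)]bin_sub; last by lia.
by rewrite subnAC.
Qed.

(** The claimed number of proper arrays with j.+1 columns and r1.+1 and r2.+1
    marks. *)
Definition proper_formula (s r1 r2 j : nat) : rat :=
  ((s + r1)`! * (s + r2)`!)%N%:R / (s + r1 + r2)`!%:R * 'C(s + r1 + r2, j)%:R
  * (('C(j, r1) * 'C(j, r2))%N%:R - ('C(j, s + r1) * 'C(j, s + r2))%N%:R).

Lemma ffact_rat n m : (m <= n)%N -> (n ^_ m)%:R = n`!%:R / (n - m)`!%:R :> rat.
Proof. by move=> mn; rewrite -(ffact_fact mn) natrM mulfK ?fact_neq0. Qed.

(** The first product of binomials in [proper_formula] produces the term that
    enters the window of [within_countS]; in [transform_bottom] the second
    product produces the term that leaves it. *)
Lemma transform_top s r1 r2 L :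
  ((s + r1)`! * (s + r2)`!)%N%:R / (s + r1 + r2)`!%:R *
  (\sum_(j < L.+1) 'C(L, j) * ('C(s + r1 + r2, j) * ('C(j, r1) * 'C(j, r2))))%N%:R
  = (level_product s r1 r2 L)%:R :> rat.
Proof.
rewrite /level_product; case: (leqP r1 L) => r1L; last first.
  rewrite (bin_small r1L) mul0n muln0 big1 ?mulr0 // => j _.
  by rewrite ['C(j, r1)]bin_small ?mul0n ?muln0 // (leq_ltn_trans _ r1L) // -ltnS.
case: (leqP r2 L) => r2L; last first.
  rewrite (bin_small r2L) muln0 muln0 big1 ?mulr0 // => j _.
  by rewrite ['C(j, r2)]bin_small ?mul0n ?muln0 // (leq_ltn_trans _ r2L) // -ltnS.
rewrite sum_four_bin ?leq_addl // addnK !natrM !bin_rat ?leq_addl // ?ffact_rat ?leq_addr //; try lia.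
have -> : (s + r1 + r2 - r2 = s + r1)%N by lia.
have -> : (L - r1 + (s + r1) = s + L)%N by lia.
have -> : (s + L - (L - r2) = s + r2)%N by lia.
have -> : (s + L - s = L)%N by lia.
by field; rewrite !fact_neq0.
Qed.

Lemma transform_bottom s r1 r2 L :
  ((s + r1)`! * (s + r2)`!)%N%:R / (s + r1 + r2)`!%:R *
  (\sum_(j < L.+1) 'C(L, j) * ('C(s + r1 + r2, j) * ('C(j, s + r1) * 'C(j, s + r2))))%N%:R
  = (if s <= L then level_product s r1 r2 (L - s) else 0)%N%:R :> rat.
Proof.
case: (leqP (s + r1) L) => r1L; last first.
  rewrite big1 ?mulr0 => [|j _]; last first.
    by rewrite ['C(j, s + r1)]bin_small ?mul0n ?muln0 // (leq_ltn_trans _ r1L) // -ltnS.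
  by case: ifP => // sL; rewrite /level_product ['C(_, r1)]bin_small ?mul0n ?muln0 //; lia.
case: (leqP (s + r2) L) => r2L; last first.
  rewrite big1 ?mulr0 => [|j _]; last first.
    by rewrite ['C(j, s + r2)]bin_small ?mul0n ?muln0 // (leq_ltn_trans _ r2L) // -ltnS.
  by case: ifP => // sL; rewrite /level_product ['C(_, r2)]bin_small ?mul0n ?muln0 //; lia.
have sL : (s <= L)%N by lia.
rewrite sL /level_product sum_four_bin //; last by lia.
have -> : (s + r1 + r2 - (s + r2) = r1)%N by lia.
have -> : (L - (s + r1) + r1 = L - s)%N by lia.
rewrite subnKC // !natrM !bin_rat ?ffact_rat; try lia.
have -> : (s + r1 + r2 - (s + r2) = r1)%N by lia.
have -> : (L - s - (L - (s + r2)) = r2)%N by lia.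
rewrite -!subnDA.
by field; rewrite !fact_neq0.
Qed.

(** Arrays have a vertex, so none has an empty support: hence the value 0 at k
    = 0. *)
Definition support_formula (s r1 r2 k : nat) : rat :=
  if k is j.+1 then proper_formula s r1 r2 j else 0.

(** By Pascal's rule the increment of the left-hand side from k to k + 1 is
    the sum of 'C(k, j) * proper_formula j, which the two transforms identify
    with the increment of [within_count]. *)
Lemma sum_support_formula s r1 r2 k : (0 < s)%N ->
  \sum_(j < k.+1) 'C(k, j)%:R * support_formula s r1 r2 j
   = (within_count s r1 r2 k)%:R.
Proof.
move=> s0; elim: k => [|k IH]; first by rewrite big_ord1 mulr0 /within_count big_ord0.
have /(congr1 (fun n : nat => n%:R : rat)) := within_countS r1 r2 k s0.
rewrite !natrD => /(canRL (addrK _))->; rewrite -IH -transform_top -transform_bottom.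
have drop0 n m : \sum_(j < n.+1) 'C(m, j)%:R * support_formula s r1 r2 j
    = \sum_(j < n) 'C(m, j.+1)%:R * proper_formula s r1 r2 j.
  by rewrite big_ord_recl [support_formula _ _ _ _]/= mulr0 add0r.
rewrite !drop0 -addrA -mulrBr !natr_sum -sumrB big_distrr /=.
have -> : \sum_(i < k) 'C(k, i.+1)%:R * proper_formula s r1 r2 i
   = \sum_(i < k.+1) 'C(k, i.+1)%:R * proper_formula s r1 r2 i.
  by rewrite [RHS]big_ord_recr /= bin_small // mul0r addr0.
rewrite -big_split /=; apply: eq_bigr => i _.
rewrite binS natrD /proper_formula !natrM; ring.
Qed.

(** * Acyclicity as a signed sum of partial permutations *)

(** A permutation of S is encoded as a permutation of I that fixes the
    complement of S: its sign is the same, and at most one u agrees with f on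
    S. *)
Definition agrees (I : finType) (f : I -> I) (S : {set I}) (u : {perm I}) :=
  perm_on S u && [forall j in S, f j == u j].

Section Forest.
Variables (K : nat) (f : 'I_K -> 'I_K) (A : {set 'I_K}).

Definition step : rel 'I_K := [rel k l | (k \in A) && (f k == l)].
Definition escapes j := [exists r, (r \notin A) && connect step j r].

Lemma escapes_out j : j \notin A -> escapes j.
Proof. by move=> jA; apply/existsP; exists j; rewrite jA connect0. Qed.

Lemma escapes_step j : j \in A -> escapes (f j) = escapes j.
Proof.
move=> jA; apply: eq_existsb => r; case rA: (r \notin A) => //=.
apply/idP/idP => [|/connectP[[|k p] /=]].
- by apply: connect_trans; apply: connect1; rewrite /step /= jA eqxx.
- by move=> _ E; rewrite E jA in rA.
- by case/andP=> /andP[_ /eqP <-] ep ->; apply/connectP; exists p.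
Qed.

Definition stepmx : 'M[rat]_K :=
  \matrix_(i, j) ((i == j)%:R - ((i \in A) && (f i == j))%:R).

Lemma det_stepmx : \det stepmx =
  \sum_(S : {set 'I_K} | S \subset A) \sum_(u | agrees f S u) (-1) ^+ #|S| * (-1) ^+ u.
Proof.
rewrite (exchange_big_dep predT) //=; apply: eq_bigr => u _.
under eq_bigr => i _ do rewrite mxE addrC.
rewrite bigA_distr big_distrr /= [RHS]big_mkcond /= [LHS]big_mkcond /=; apply: eq_bigr => S _.
case: ifP => [/andP[SA /andP[uS /forall_inP fu]]|/negbT nb].
  rewrite mulrC; congr (_ * _).
  rewrite -prodr_const [RHS]big_mkcond; apply: eq_bigr => i _.
  case: ifPn => iS; first by rewrite (subsetP SA) // fu.
  by rewrite (out_perm uS iS) eqxx.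
suff [i i0] : exists i, (if i \in S then - ((i \in A) && (f i == u i))%:R
                                 else (i == u i)%:R : rat) = 0.
  by rewrite (bigD1 i) //= i0 mul0r mulr0.
move: nb; rewrite negb_and => /orP[/subsetPn[i iS iA]|].
  by exists i; rewrite iS (negbTE iA) oppr0.
rewrite negb_and => /orP[/subsetPn[i]|].
  by rewrite inE eq_sym => iu iS; exists i; rewrite (negbTE iS) (negbTE iu).
by rewrite negb_forall_in => /exists_inP[i iS fu]; exists i; rewrite iS (negbTE fu) andbF oppr0.
Qed.

(** The sum is the determinant of the identity minus the matrix of f on A. The
    indicator of the points that never escape from A is in the kernel of this
    matrix, so the determinant vanishes if there are any. Otherwise f permutes
    no non-empty subset of A, and only S = set0 contributes. *)
Lemma signed_forest_sum :
  \sum_(S : {set 'I_K} | S \subset A) \sum_(u | agrees f S u) (-1) ^+ #|S| * (-1) ^+ u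
  = [forall j in A, escapes j]%:R :> rat.
Proof.
case: (boolP [forall j in A, escapes j]) => [/forall_inP esc|]; last first.
  rewrite negb_forall_in => /exists_inP[j jA jN]; rewrite -det_stepmx -det_tr.
  apply/eqP/det0P; exists (\row_i (~~ escapes i)%:R).
    by apply/eqP => /rowP/(_ j)/eqP; rewrite !mxE jN oner_eq0.
  apply/rowP => i; rewrite !mxE.
  under eq_bigr => k _ do rewrite !mxE mulrBr.
  rewrite sumrB (bigD1 i) //= eqxx mulr1 big1 ?addr0 => [|k ki]; last first.
    by rewrite eq_sym (negbTE ki) mulr0.
  case: (boolP (i \in A)) => iA /=.
    rewrite (bigD1 (f i)) //= eqxx mulr1 big1 ?addr0 => [|k ki]; last first.
      by rewrite eq_sym (negbTE ki) mulr0.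
    by rewrite escapes_step // subrr.
  by rewrite escapes_out //= sub0r big1 ?oppr0 // => k _; rewrite mulr0.
rewrite (bigD1 set0) ?sub0set //= [X in _ + X]big1 ?addr0 => [|S /andP[SA /set0Pn[j jS]]].
  rewrite (bigD1 1%g) /=; last first.
    by rewrite /agrees perm_on1; apply/forall_inP => i; rewrite inE.
  rewrite cards0 odd_perm1 mulr1 big1 ?addr0 // => u /andP[/andP[uS _] /eqP[]].
  by apply/permP => i; rewrite perm1 (out_perm uS) ?inE.
rewrite big1 // => u /andP[uS /forall_inP fu].
have /existsP[r /andP[rA /connectP[p ep er]]] := esc j (subsetP SA j jS).
suff rS : r \in S by rewrite (subsetP SA) in rA.
rewrite er; elim: p j jS ep {er} => //= k p IH j jS /andP[/andP[_ /eqP fj]].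
by apply: IH; rewrite -fj (eqP (fu _ jS)) perm_closed.
Qed.
End Forest.

(** * Sign-reversing involutions and permutations with prescribed values *)

Lemma signed_involution (T : finType) (P : pred T) (F : T -> rat) (g : T -> T) :
  (forall t, P t -> [/\ P (g t), g (g t) = t & F (g t) = - F t]) ->
  \sum_(t | P t) F t = 0.
Proof.
move=> gP; set X := \sum_(t | P t) F t.
suff : X = - X by move=> E; lra.
rewrite {1}/X (reindex_onto g g) /= => [|t /gP[] //].
rewrite /X -sumrN; apply: eq_big => t; last first.
  by move=> /andP[Pgt /eqP ggt]; have [] := gP _ Pgt; rewrite ggt => _ _ ->; rewrite opprK.
apply/idP/idP => [/andP[Pgt /eqP ggt]|Pt]; first by have [] := gP _ Pgt; rewrite ggt.
by have [-> -> _] := gP _ Pt; rewrite eqxx.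
Qed.

Section PermCount.
Variable V : finType.
Implicit Types (U B D : {set V}) (g : V -> V) (m : {perm V}).

Definition extends U g m := [forall v in U, m v == g v].

Lemma extension_exists U g : {in U &, injective g} -> exists m, extends U g m.
Proof.
have [n] := ubnP #|U|; elim: n U => // n IH U Un injg.
have [->|[x xU]] := set_0Vmem U.
  by exists 1%g; apply/forall_inP => v; rewrite inE.
have [||m /forall_inP mE] := IH (U :\ x).
- by move: Un; rewrite (cardsD1 x U) xU.
- by move=> v w /setD1P[_ vU] /setD1P[_ wU]; apply: injg.
exists (m * tperm (m x) (g x))%g; apply/forall_inP => v vU; rewrite permM.
have [->|vx] := eqVneq v x; first by rewrite tpermL.
have mv : m v = g v by apply/eqP/mE; rewrite !inE vx.
rewrite tpermD ?mv //; first by rewrite -mv (inj_eq perm_inj) eq_sym.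
by apply: contra vx => /eqP/(injg _ _ xU vU)->.
Qed.

(** Any two extensions differ by a permutation that fixes U pointwise. *)
Lemma card_extensions U g : {in U &, injective g} ->
  #|[set m | extends U g m]| = (#|V| - #|U|)`!.
Proof.
move=> /extension_exists[m0 /forall_inP m0E].
have -> : (#|V| - #|U| = #|~: U|)%N by rewrite [RHS]cardsCs setCK.
rewrite -card_perm -[LHS](card_imset _ (mulIg m0^-1)%g).
apply: eq_card => m; rewrite [RHS]inE; apply/imsetP/idP => [[k]|/subsetP mU].
  rewrite inE => /forall_inP kE ->; apply/subsetP => v; rewrite !inE.
  apply: contra => vU; rewrite permM (eqP (kE v vU)) -(eqP (m0E v vU)) permK //.
exists (m * m0)%g; last by rewrite mulgK.
rewrite inE; apply/forall_inP => v vU; rewrite permM.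
have -> : m v = v by apply/eqP; apply: contraTT vU => /mU; rewrite inE.
exact: m0E.
Qed.

Lemma card_extensions_in U g y B : {in U &, injective g} -> y \notin U ->
  {in U, forall v, g v \notin B} ->
  #|[set m | extends U g m & m y \in B]| = (#|B| * (#|V| - #|U|.+1)`!)%N.
Proof.
move=> injg yU gB; rewrite -sum1_card (partition_big (fun m : {perm V} => m y) (mem B)) /=; last first.
  by move=> m; rewrite inE => /andP[].
rewrite -sum_nat_const; apply: eq_bigr => b bB.
(* Once the value b at y is chosen, m is prescribed on one point more. *)
pose g' v := if v == y then b else g v.
rewrite -[in RHS](_ : #|y |: U| = #|U|.+1); last by rewrite cardsU1 yU.
rewrite -(@card_extensions _ g'); last first.
  move=> v w /setU1P[->|vU] /setU1P[->|wU] //; rewrite /g' ?eqxx.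
  - by case: eqP wU yU => [->->//|_ wU _ E]; rewrite E (negbTE (gB w wU)) in bB.
  - by case: eqP vU yU => [->->//|_ vU _ E]; rewrite -E (negbTE (gB v vU)) in bB.
  - case: eqP vU yU => [->->//|_ vU _]; case: eqP wU => [->|_ wU]; last exact: injg.
    by move=> yU E; rewrite -E (negbTE (gB v vU)) in bB.
rewrite sum1dep_card; apply: eq_card => m; rewrite !inE.
apply/idP/idP => [/andP[/andP[/forall_inP mE _] /eqP my]|/forall_inP mE].
  apply/forall_inP => v /setU1P[->|vU]; rewrite /g' ?eqxx ?my //.
  by case: (v =P y) => [->|_]; [rewrite my | apply: mE].
have my : m y = b by apply/eqP; have := mE y; rewrite setU11 /g' eqxx; apply.
rewrite my bB eqxx !andbT; apply/forall_inP => v vU.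
have := mE v; rewrite setU1r // /g'; case: (v =P y) vU yU => [->->//|_ _ _]; exact.
Qed.

(** The hypotheses make the choices of m y in B and of the preimage of w in D
    independent; they prescribe m at two points more than U. *)
Lemma card_extensions_in2 U g y B w D : {in U &, injective g} -> y \notin U ->
  {in U, forall v, g v \notin B} -> {in U, forall v, g v != w} -> w \notin B ->
  y \notin D -> [disjoint D & U] ->
  #|[set m | [&& extends U g m, m y \in B & (m^-1)%g w \in D]]|
     = (#|B| * #|D| * (#|V| - #|U|.+2)`!)%N.
Proof.
move=> injg yU gB gw wB yD DU.
rewrite -sum1_card (partition_big (fun m : {perm V} => (m^-1)%g w) (mem D)) /=; last first.
  by move=> m; rewrite inE => /and3P[].
rewrite mulnAC mulnC -sum_nat_const; apply: eq_bigr => d dD.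
have dU : d \notin U by rewrite (disjointFr DU).
(* Prescribing d as the preimage of w amounts to prescribing w at d. *)
pose g' v := if v == d then w else g v.
rewrite -[in RHS](_ : #|d |: U| = #|U|.+1); last by rewrite cardsU1 dU.
rewrite -(@card_extensions_in _ g' y); first last.
- by move=> v /setU1P[->|vU]; rewrite /g' ?eqxx //; case: eqP => // _; apply: gB.
- by rewrite !inE negb_or yU andbT; apply: contraNneq yD => ->.
- move=> v v' /setU1P[->|vU] /setU1P[->|vU'] //; rewrite /g' ?eqxx.
  - by case: eqP vU' dU => [->->//|_ vU' _ E]; have := gw _ vU'; rewrite E eqxx.
  - by case: eqP vU dU => [->->//|_ vU _ E]; have := gw _ vU; rewrite E eqxx.
  - case: eqP vU dU => [->->//|_ vU _]; case: eqP vU' => [->|_ vU']; last exact: injg.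
    by move=> _ E; have := gw _ vU; rewrite E eqxx.
rewrite sum1dep_card; apply: eq_card => m; rewrite !inE.
apply/idP/idP => [/andP[/and3P[/forall_inP mE -> _] /eqP mw]|/andP[/forall_inP mE ->]].
  rewrite andbT; apply/forall_inP => v /setU1P[->|vU]; rewrite /g'.
    by rewrite eqxx -mw permKV.
  by case: (v =P d) => [->|_]; [rewrite -mw permKV | apply: mE].
have mw : (m^-1)%g w = d.
  by have := mE d; rewrite setU11 /g' eqxx => /(_ isT)/eqP <-; rewrite permK.
rewrite mw dD eqxx !andbT; apply/forall_inP => v vU.
have := mE v; rewrite setU1r // /g'; case: (v =P d) vU dU => [->->//|_ _ _]; exact.
Qed.
End PermCount.

(** * Cancellation in the signed count of matchings *)

Section Signed.
Variables (V I : finType) (c : V -> I) (a : I -> V) (F : {set I}).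
Hypothesis ca : {in F, cancel a c}.
Implicit Types (S C : {set I}) (m : {perm V}) (u : {perm I}).

(** The map psi of one row. The intended meaning is: V is the set of positions
    of a row, c v the column of v, F the set of occupied columns and a j the
    last position in column j. The map psi of the other row is [next_column
    m^-1]. *)
Definition next_column m j := c (m (a j)).

(** The partners of the last vertices of these columns can be exchanged
    without affecting the permutation induced on S2 in the other row. *)
Definition loose S1 S2 m := [set j in S1 | m (a j) \notin a @: S2].

Definition config S1 S2 (t : {perm V} * ({perm I} * {perm I})) :=
  agrees (next_column t.1) S1 t.2.1 && agrees (next_column t.1^-1) S2 t.2.2.

Definition config_sign (t : {perm V} * ({perm I} * {perm I})) : rat := (-1) ^+ t.2.1 * (-1) ^+ t.2.2.

Definition signed_sum S1 S2 : rat := \sum_(t | config S1 S2 t) config_sign t.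

Lemma inj_a : {in F &, injective a}.
Proof. exact: can_in_inj ca. Qed.

Definition pick_two (L : {set I}) : option (I * I) :=
  [pick xy | [&& xy.1 \in L, xy.2 \in L & xy.1 != xy.2]].

(** The two columns are chosen from the set of loose columns alone. The
    exchange preserves this set, so it is an involution. *)
Definition swap_loose S1 S2 (t : {perm V} * ({perm I} * {perm I})) :=
  if pick_two (loose S1 S2 t.1) is Some (x, y)
  then ((tperm (a x) (a y) * t.1)%g, ((tperm x y * t.2.1)%g, t.2.2)) else t.

Lemma loose_tperm S1 S2 m x y : S1 \subset F ->
  x \in loose S1 S2 m -> y \in loose S1 S2 m ->
  loose S1 S2 (tperm (a x) (a y) * m) = loose S1 S2 m.
Proof.
move=> S1F; rewrite !inE => /andP[xS xN] /andP[yS yN]; apply/setP => j; rewrite !inE permM.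
case jS: (j \in S1) => //=.
have [->|jx] := eqVneq j x; first by rewrite tpermL xN yN.
have [->|jy] := eqVneq j y; first by rewrite tpermR xN yN.
have ne z : z \in S1 -> j != z -> a z != a j.
  by move=> zS; apply: contra_neq => /inj_a->; rewrite ?(subsetP S1F).
by rewrite tpermD ?ne.
Qed.

(** The permutation u is multiplied by a transposition. The permutation u'
    still agrees with the new matching, because the vertices whose partners
    change are not matched to last vertices of columns of S2. *)
Lemma swap_looseP S1 S2 t : S1 \subset F -> S2 \subset F ->
  config S1 S2 t -> (1 < #|loose S1 S2 t.1|)%N ->
  [/\ config S1 S2 (swap_loose S1 S2 t), loose S1 S2 (swap_loose S1 S2 t).1 = loose S1 S2 t.1,
      swap_loose S1 S2 (swap_loose S1 S2 t) = t & config_sign (swap_loose S1 S2 t) = - config_sign t].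
Proof.
case: t => m [u u'] S1F S2F /andP[/= /andP[uS /forall_inP uE] /andP[uS' /forall_inP uE']] L2.
have [x [y [xL yL xy Ep]]] : exists x y, [/\ x \in loose S1 S2 m, y \in loose S1 S2 m,
    x != y & pick_two (loose S1 S2 m) = Some (x, y)].
  rewrite /pick_two; case: pickP => [[x y] /= /and3P[xL yL xy]|no]; first by exists x, y.
  by have /card_gt1P[x [y [xL yL xy]]] := L2; have /= := no (x, y); rewrite xL yL xy.
have E := loose_tperm S1F xL yL.
have -> : swap_loose S1 S2 (m, (u, u')) =
    ((tperm (a x) (a y) * m)%g, ((tperm x y * u)%g, u')) by rewrite /swap_loose /= Ep.
rewrite /swap_loose /= E Ep !mulgA !tperm2 !mul1g; split=> //; last first.
  rewrite -[LHS]/((-1) ^+ odd_perm (tperm x y * u) * (-1) ^+ odd_perm u') odd_mul_tperm xy.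
  by rewrite signr_addb expr1 mulN1r mulNr.
have [xS xN] : x \in S1 /\ m (a x) \notin a @: S2 by move: xL; rewrite inE => /andP[].
have [yS yN] : y \in S1 /\ m (a y) \notin a @: S2 by move: yL; rewrite inE => /andP[].
apply/andP; split; apply/andP; split=> //=.
- apply: perm_onM uS; apply/subsetP => z; rewrite !inE.
  by case: tpermP => [-> //|-> //|_ _]; rewrite eqxx.
- apply/forall_inP => j jS; rewrite /next_column !permM.
  have [->|jx] := eqVneq j x; first by rewrite !tpermL; apply: uE.
  have [->|jy] := eqVneq j y; first by rewrite !tpermR; apply: uE.
  have ne z : z \in S1 -> j != z -> a z != a j.
    by move=> zS; apply: contra_neq => /inj_a->; rewrite ?(subsetP S1F).
  by rewrite !tpermD ?ne // ?uE // eq_sym.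
- apply/forall_inP => j jS; rewrite /next_column invMg tpermV permM tpermD ?uE' //.
    by apply: contraNneq xN => ->; rewrite permKV imset_f.
  by apply: contraNneq yN => ->; rewrite permKV imset_f.
Qed.

(** The predicate q lets a bound on the other row survive the cancellation: by
    [card_loose] such a bound is a condition on the number of loose columns of
    this row. *)
Lemma cancel_loose S1 S2 (q : pred nat) : S1 \subset F -> S2 \subset F ->
  \sum_(t | [&& config S1 S2 t, 1 < #|loose S1 S2 t.1| & q #|loose S1 S2 t.1|]%N) config_sign t = 0.
Proof.
move=> S1F S2F; apply: (@signed_involution _ _ _ (swap_loose S1 S2)) => t /and3P[tc tl tq].
by have [-> -> -> ->] := swap_looseP S1F S2F tc tl; split; rewrite // tl tq.
Qed.

(** Column sets S1 and S2 have equally many columns that are not loose, namely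
    the number of last vertices of S1 matched to last vertices of S2. *)
Lemma card_loose S1 S2 m : S1 \subset F -> S2 \subset F ->
  (#|loose S1 S2 m| + #|S2| = #|loose S2 S1 m^-1| + #|S1|)%N.
Proof.
have aux (A B : {set I}) (k : {perm V}) : A \subset F ->
    (#|A| = #|k @: (a @: A) :&: a @: B| + #|loose A B k|)%N.
  move=> AF; have injA : {in A &, injective a} by apply: sub_in2 inj_a; apply: (subsetP AF).
  rewrite -{1}(card_in_imset injA) -{1}(card_imset _ (@perm_inj _ k)) -(cardsID (a @: B)).
  congr addn; rewrite -(card_in_imset (f := k \o a) (D := loose A B k)); last first.
    by move=> i j; rewrite !inE => /andP[iA _] /andP[jA _] /perm_inj/injA; apply.
  apply: eq_card => v; rewrite !inE; apply/andP/imsetP => [[vB /imsetP[w /imsetP[j jA ->] E]]|[j]].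
    by exists j => //; rewrite inE jA -E.
  by rewrite inE => /andP[jA jB] -> /=; rewrite jB; split=> //; do 2!apply: imset_f.
move=> S1F S2F; have := aux S1 S2 m S1F; have := aux S2 S1 (m^-1)%g S2F.
have -> : #|(m^-1)%g @: (a @: S2) :&: a @: S1| = #|m @: (a @: S1) :&: a @: S2|.
  rewrite -(card_imset _ (@perm_inj _ m)) imsetI; last by move=> ? ? _ _; apply: perm_inj.
  by rewrite -imset_comp (eq_imset (g := id)) ?imset_id 1?setIC // => v /=; rewrite permKV.
lia.
Qed.

Definition tame S1 S2 m := (#|loose S1 S2 m| <= 1)%N && (#|loose S2 S1 m^-1| <= 1)%N.

Definition flip (t : {perm V} * ({perm I} * {perm I})) := ((t.1^-1)%g, (t.2.2, t.2.1)).

Lemma flipK : involutive flip.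
Proof. by case=> m [u u']; rewrite /flip /= invgK. Qed.

Lemma config_flip S1 S2 t : config S1 S2 (flip t) = config S2 S1 t.
Proof. by rewrite /config /= invgK andbC. Qed.

Lemma config_sign_flip t : config_sign (flip t) = config_sign t.
Proof. by rewrite /config_sign mulrC. Qed.

Lemma signed_sumC S1 S2 : signed_sum S1 S2 = signed_sum S2 S1.
Proof.
rewrite /signed_sum (reindex_inj (can_inj flipK)).
by apply: eq_big => t; rewrite ?config_flip ?config_sign_flip.
Qed.

(** Cancel first in one row, then in the other. *)
Lemma signed_sum_tame S1 S2 : S1 \subset F -> S2 \subset F ->
  signed_sum S1 S2 = \sum_(t | config S1 S2 t && tame S1 S2 t.1) config_sign t.
Proof.
move=> S1F S2F; rewrite /signed_sum (bigID (fun t => #|loose S1 S2 t.1| <= 1)%N) /=.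
rewrite [X in _ + X](_ : _ = 0) ?addr0; last first.
  rewrite -[RHS](cancel_loose predT S1F S2F); apply: eq_bigl => t.
  by rewrite andbT ltnNge.
rewrite (bigID (fun t => #|loose S2 S1 t.1^-1| <= 1)%N) /= [X in _ + X](_ : _ = 0) ?addr0.
  by apply: eq_bigl => t; rewrite /tame andbA.
rewrite (reindex_inj (can_inj flipK)).
rewrite -[RHS](cancel_loose (fun n => n + #|S1| <= 1 + #|S2|)%N S2F S1F).
apply: eq_big => t; last by rewrite config_sign_flip.
have E := card_loose t.1 S2F S1F.
have -> : (#|loose S2 S1 t.1| + #|S1| <= 1 + #|S2|)%N = (#|loose S1 S2 t.1^-1| <= 1)%N.
  by rewrite E leq_add2r.
by rewrite config_flip /= invgK -ltnNge andbAC andbA.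
Qed.

Lemma tightP S1 S2 m u j : S2 \subset F -> agrees (next_column m) S1 u ->
  j \in S1 -> j \notin loose S1 S2 m -> [/\ u j \in S1, u j \in S2 & m (a j) = a (u j)].
Proof.
move=> S2F /andP[uS /forall_inP uE] jS; rewrite inE jS /= negbK => /imsetP[z zS E].
have Ez : u j = z by rewrite -(eqP (uE j jS)) /next_column E ca // (subsetP S2F).
by rewrite perm_closed // Ez.
Qed.

Lemma tight_mem S1 S2 m u u' j : S1 \subset F -> S2 \subset F ->
  agrees (next_column m) S1 u -> agrees (next_column m^-1) S2 u' ->
  j \in S1 -> j \notin loose S1 S2 m -> u' (u j) = j /\ j \in S2.
Proof.
move=> S1F S2F hu hu' jS jL; have [_ uj2 E] := tightP S2F hu jS jL.
have [uS' /forall_inP uE'] := andP hu'.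
have E' : u' (u j) = j.
  by rewrite -(eqP (uE' _ uj2)) /next_column -E permK ca // (subsetP S1F).
by split; rewrite // -E' perm_closed.
Qed.

(** By [tight_mem] and the bound in the second row, u followed by u' fixes
    every column that is not loose; a permutation that moves at most one point
    is the identity. *)
Lemma tame_inverse S1 S2 m u u' : S1 \subset F -> S2 \subset F ->
  agrees (next_column m) S1 u -> agrees (next_column m^-1) S2 u' -> tame S1 S2 m -> u' = (u^-1)%g.
Proof.
move=> S1F S2F hu hu' /andP[L1 L2].
have [uS _] := andP hu; have [uS' _] := andP hu'.
have hu1 : agrees (next_column (m^-1)^-1) S1 u by rewrite invgK.
have fixed j : j \notin loose S1 S2 m -> u' (u j) = j.
  move=> jL; have [jS|jS] := boolP (j \in S1); first by have [] := tight_mem S1F S2F hu hu' jS jL.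
  rewrite (out_perm uS jS); have [jS2|jS2] := boolP (j \in S2); last by rewrite (out_perm uS').
  have jL2 : j \in loose S2 S1 m^-1.
    by apply: contraR jS => jL2; have [] := tight_mem S2F S1F hu' hu1 jS2 jL2.
  (* As j is the only loose column of S2, a preimage z of j under u' other
     than j would not be loose, and [tightP] would put j in S1. *)
  set z := (u'^-1)%g j; have Ez : u' z = j by rewrite permKV.
  have zS : z \in S2 by rewrite -(perm_closed _ uS') Ez.
  have [E|zj] := eqVneq z j; first by rewrite -{1}E.
  have zL : z \notin loose S2 S1 m^-1.
    apply: contraTN L2 => zL; rewrite -ltnNge.
    by apply/card_gt1P; exists z, j.
  by have [] := tightP S1F hu' zS zL; rewrite Ez (negbTE jS).
suff uK : (u * u' = 1)%g by rewrite -[u']mul1g -(mulVg u) -mulgA uK mulg1.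
apply/permP => j; rewrite permM perm1; apply/eqP.
have [jL|/fixed/eqP//] := boolP (j \in loose S1 S2 m).
apply/eqP; apply: contraTeq L1 => nj; rewrite -ltnNge; apply/card_gt1P.
exists (u' (u j)), j; split=> //; apply: contraR nj => /fixed E.
by apply/eqP; apply: (@perm_inj _ u); apply: (@perm_inj _ u').
Qed.

Definition tame_set S1 S2 u := [set m | [&& agrees (next_column m) S1 u, agrees (next_column m^-1) S2 u^-1 & tame S1 S2 m]].

(** By [tame_inverse] the two signs multiply to 1, so that only a cardinality
    remains. *)
Lemma signed_sum_count S1 S2 : S1 \subset F -> S2 \subset F ->
  signed_sum S1 S2 = (\sum_u #|tame_set S1 S2 u|)%N%:R.
Proof.
move=> S1F S2F; rewrite signed_sum_tame //.
transitivity (\sum_(t : {perm V} * ({perm I} * {perm I}) | config S1 S2 t && tame S1 S2 t.1) (1 : rat)).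
  apply: eq_bigr => -[m [u u']] /andP[/andP[/= hu hu'] ht].
  by rewrite (tame_inverse S1F S2F hu hu' ht) /config_sign /= odd_permV -signr_addb addbb.
rewrite natr_sum; under [RHS]eq_bigr => u _ do rewrite -sum1_card natr_sum.
rewrite pair_big_dep /= (reindex_onto (fun um : {perm I} * {perm V} => (um.2, (um.1, um.1^-1)%g))
   (fun t => (t.2.1, t.1))) /=.
  apply: eq_bigl => -[u m]; rewrite /= eqxx andbT inE /config /= andbA //.
move=> [m [u u']] /= /andP[/andP[/= hu hu'] ht].
by rewrite (tame_inverse S1F S2F hu hu' ht).
Qed.

Lemma diff_loose S1 S2 m u u' : S1 \subset F -> S2 \subset F ->
  agrees (next_column m) S1 u -> agrees (next_column m^-1) S2 u' -> S1 :\: S2 \subset loose S1 S2 m.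
Proof.
move=> S1F S2F hu hu'; apply/subsetP => j /setDP[jS]; apply: contraR => jL.
by have [] := tight_mem S1F S2F hu hu' jS jL.
Qed.

Lemma signed_sum_far S1 S2 : S1 \subset F -> S2 \subset F ->
  (1 < #|S1 :\: S2|)%N -> signed_sum S1 S2 = 0.
Proof.
move=> S1F S2F lt; rewrite signed_sum_count // big1 // => u _.
apply/eqP; rewrite cards_eq0; apply/eqP/setP => m; rewrite !inE.
apply/negP => /and3P[hu hu' /andP[L1 _]].
have := subset_leq_card (diff_loose S1F S2F hu hu'); lia.
Qed.

Definition matched C m u := perm_on C u && [forall j in C, m (a j) == a (u j)].

Lemma perm_onVE S u : perm_on S (u^-1)%g = perm_on S u.
Proof. by apply/idP/idP => /perm_onV //; rewrite invgK. Qed.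

Lemma matchedV C m u : matched C m u -> matched C m^-1 u^-1.
Proof.
case/andP=> uC /forall_inP mE; rewrite /matched perm_onVE uC; apply/forall_inP => j jC.
have /mE/eqP : (u^-1)%g j \in C by rewrite perm_closed ?perm_onVE.
by rewrite permKV => <-; rewrite permK.
Qed.

Lemma matched_agrees S C m u : C \subset S -> S \subset F -> matched C m u ->
  {in S :\: C, forall x, next_column m x = x} -> agrees (next_column m) S u.
Proof.
move=> CS SF /andP[uC /forall_inP mE] fix_out.
have uS : perm_on S u := subset_trans uC CS; rewrite /agrees uS /=.
apply/forall_inP => j jS; have [jC|jC] := boolP (j \in C).
  by rewrite /next_column (eqP (mE j jC)) ca // (subsetP SF) // (subsetP CS) // perm_closed.
by rewrite fix_out ?(out_perm uC) // inE jC.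
Qed.

Lemma matched_loose S1 S2 C m u : C \subset S2 -> matched C m u -> loose S1 S2 m \subset S1 :\: C.
Proof.
move=> CS /andP[uC /forall_inP mE]; apply/subsetP => j; rewrite !inE => /andP[-> jL].
rewrite andbT; apply: contra jL => jC; rewrite (eqP (mE j jC)) imset_f // (subsetP CS) //.
by rewrite perm_closed.
Qed.

Lemma tame_matched S1 S2 m u : S1 \subset F -> S2 \subset F -> S1 :\: S2 != set0 ->
  m \in tame_set S1 S2 u -> matched (S1 :&: S2) m u.
Proof.
move=> S1F S2F /set0Pn[x xS]; rewrite inE => /and3P[hu hu' /andP[L1 _]].
have [uS _] := andP hu; have [] := andP hu'; rewrite perm_onVE => uS' _.
apply/andP; split.
  by apply/subsetP => j uj; rewrite inE (subsetP uS) // (subsetP uS').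
apply/forall_inP => j /setIP[jS1 jS2].
have jL : j \notin loose S1 S2 m.
  apply: contraTN L1 => jL; rewrite -ltnNge; apply/card_gt1P; exists x, j; split=> //.
    exact: (subsetP (diff_loose S1F S2F hu hu')).
  by apply: contraTneq xS => ->; rewrite inE jS2.
by have [_ _ ->] := tightP S2F hu jS1 jL.
Qed.

Lemma tame_setV S1 S2 m u : (m^-1 \in tame_set S2 S1 u^-1)%g = (m \in tame_set S1 S2 u).
Proof.
rewrite !inE /tame !invgK.
by apply/and3P/and3P => -[-> -> /andP[-> ->]].
Qed.

(** A column in the difference of S1 and S2 is loose, and exhausts what
    tameness allows: all common columns are matched along u, and u fixes the
    columns in the difference. *)
Lemma tame_set_neq S1 S2 u : S1 \subset F -> S2 \subset F -> S1 != S2 ->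
  (#|S1 :\: S2| <= 1)%N -> (#|S2 :\: S1| <= 1)%N ->
  tame_set S1 S2 u = [set m | [&& matched (S1 :&: S2) m u,
     [forall x in S1 :\: S2, next_column m x == x] & [forall z in S2 :\: S1, next_column m^-1 z == z]]].
Proof.
move=> S1F S2F neqS le1 le2; apply/setP => m; rewrite [RHS]inE.
apply/idP/and3P => [mT|[hm /forall_inP h1 /forall_inP h2]].
  have hm : matched (S1 :&: S2) m u.
    have [E|/set0Pn ne] := eqVneq (S1 :\: S2) set0; last first.
      by apply: tame_matched mT => //; apply/set0Pn.
    rewrite -[m]invgK -[u]invgK setIC; apply/matchedV/tame_matched; rewrite ?tame_setV //.
    by apply: contraNneq neqS => E'; rewrite eqEsubset -!setD_eq0 E E' eqxx.
  move: mT; rewrite inE => /and3P[/andP[uS /forall_inP uE] /andP[uS' /forall_inP uE'] _]; split=> //.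
    apply/forall_inP => x /setDP[xS xN]; rewrite (eqP (uE _ xS)).
    by rewrite perm_onVE in uS'; rewrite (out_perm uS').
  apply/forall_inP => x /setDP[xS xN]; rewrite (eqP (uE' _ xS)).
  by rewrite -perm_onVE in uS; rewrite (out_perm uS).
have IU : S1 :\: (S1 :&: S2) = S1 :\: S2 by rewrite setDIr setDv set0U.
have IU' : S2 :\: (S1 :&: S2) = S2 :\: S1 by rewrite setDIr setDv setU0.
rewrite inE; apply/and3P; split.
- by apply: (matched_agrees (C := S1 :&: S2)); rewrite ?subsetIl ?IU // => x /h1/eqP.
- apply: (matched_agrees (C := S1 :&: S2)); rewrite ?subsetIr ?IU' ?matchedV // => x /h2/eqP //.
- apply/andP; split; [apply: leq_trans le1|apply: leq_trans le2]; apply: subset_leq_card.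
    by rewrite -IU; apply: matched_loose hm; apply: subsetIr.
  by rewrite -IU'; apply: matched_loose (matchedV hm); apply: subsetIl.
Qed.

Definition fiber x := [set v | c v == x].
Local Notation n := #|V|.

Lemma matchedE C m u : C \subset F ->
  matched C m u = perm_on C u && extends (a @: C) (fun v => a (u (c v))) m.
Proof.
move=> CF; congr (_ && _); apply/forall_inP/forall_inP => [mE v /imsetP[j jC ->]|mE j jC].
  by rewrite ca ?mE // (subsetP CF).
by have := mE _ (imset_f a jC); rewrite ca // (subsetP CF).
Qed.

Lemma inj_follow C u : C \subset F -> perm_on C u ->
  {in a @: C &, injective (fun v => a (u (c v)))}.
Proof.
move=> CF uC _ _ /imsetP[i iC ->] /imsetP[j jC ->].
rewrite !ca ?(subsetP CF) // => /inj_a E.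
by rewrite (perm_inj (E _ _)) // (subsetP CF) // perm_closed.
Qed.

Lemma card_anchors C : C \subset F -> #|a @: C| = #|C|.
Proof. by move=> CF; apply: card_in_imset; apply: sub_in2 inj_a; apply: (subsetP CF). Qed.

Lemma sum_perm_on C X : (\sum_u (if perm_on C u then X else 0) = #|C|`! * X)%N.
Proof. by rewrite -big_mkcond sum_nat_const card_perm. Qed.

Lemma signed_sum_one C x : C \subset F -> x \in F -> x \notin C ->
  signed_sum (x |: C) C = (#|C|`! * (#|fiber x| * (n - #|C|.+1)`!))%N%:R.
Proof.
move=> CF xF xC; have xCF : x |: C \subset F by rewrite subUset sub1set xF.
have EI : (x |: C) :&: C = C by apply/setIidPr; apply: subsetUr.
have ED : (x |: C) :\: C = [set x].
  by rewrite setDUl setDv setU0; apply/setDidPl; rewrite disjoints1.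
have ED' : C :\: (x |: C) = set0 by apply/eqP; rewrite setD_eq0 subsetUr.
rewrite signed_sum_count // -sum_perm_on; congr _%:R; apply: eq_bigr => u _.
rewrite tame_set_neq //; first last.
- by rewrite ED' cards0.
- by rewrite ED cards1.
- by apply: contraNneq xC => <-; rewrite setU11.
rewrite EI ED ED'; case: ifPn => uC; last first.
  by apply/eqP; rewrite cards_eq0; apply/eqP/setP => m; rewrite !inE /matched (negbTE uC).
rewrite -(card_anchors CF) -(@card_extensions_in _ _ (fun v => a (u (c v))) (a x)) //.
- apply: eq_card => m; rewrite !inE matchedE // uC /=; congr (_ && _).
  rewrite -[RHS]andbT; congr (_ && _); last by apply/forall_inP => z; rewrite inE.
  by apply/forall_inP/idP => [->|mx z]; rewrite ?inE // => /eqP->.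
- exact: inj_follow.
- apply: contra xC => /imsetP[j jC /inj_a->] //; exact: (subsetP CF).
- move=> _ /imsetP[j jC ->]; rewrite inE !ca ?(subsetP CF) ?perm_closed //.
  by apply: contraNneq xC => <-; rewrite perm_closed.
Qed.

Lemma signed_sum_two C x z : C \subset F -> x \in F -> z \in F -> x \notin C -> z \notin C ->
  x != z ->
  signed_sum (x |: C) (z |: C) =
    (#|C|`! * (#|fiber x| * #|fiber z| * (n - #|C|.+2)`!))%N%:R.
Proof.
move=> CF xF zF xC zC xz.
have xCF : x |: C \subset F by rewrite subUset sub1set xF.
have zCF : z |: C \subset F by rewrite subUset sub1set zF.
have EI : (x |: C) :&: (z |: C) = C.
  apply/setP => j; rewrite !inE; case: (eqVneq j x) => [->|_]; last by case: (j \in C); rewrite ?orbT ?andbF.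
  by rewrite (negbTE xz) (negbTE xC).
have ED : (x |: C) :\: (z |: C) = [set x].
  apply/setP => j; rewrite !inE; case: (eqVneq j x) => [->|_]; first by rewrite (negbTE xz) (negbTE xC).
  by case: (j \in C); rewrite ?orbT ?andbF.
have ED' : (z |: C) :\: (x |: C) = [set z].
  apply/setP => j; rewrite !inE; case: (eqVneq j z) => [->|_].
    by rewrite eq_sym (negbTE xz) (negbTE zC).
  by case: (j \in C); rewrite ?orbT ?andbF.
rewrite signed_sum_count // -sum_perm_on; congr _%:R; apply: eq_bigr => u _.
rewrite tame_set_neq //; first last.
- by rewrite ED' cards1.
- by rewrite ED cards1.
- by apply: contraNneq xC => E; have := setU11 x C; rewrite E !inE (negbTE xz).
rewrite EI ED ED'; case: ifPn => uC; last first.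
  by apply/eqP; rewrite cards_eq0; apply/eqP/setP => m; rewrite !inE /matched (negbTE uC).
rewrite -(card_anchors CF) -(@card_extensions_in2 _ _ (fun v => a (u (c v))) (a x) _ (a z)) //.
- apply: eq_card => m; rewrite !inE matchedE // uC /=; congr [&& _, _ & _].
    by apply/forall_inP/idP => [->|mx j]; rewrite ?inE // => /eqP->.
  by apply/forall_inP/idP => [->|mx j]; rewrite ?inE // => /eqP->.
- exact: inj_follow.
- apply: contra xC => /imsetP[j jC /inj_a->] //; exact: (subsetP CF).
- move=> _ /imsetP[j jC ->]; rewrite inE !ca ?(subsetP CF) ?perm_closed //.
  by apply: contraNneq xC => <-; rewrite perm_closed.
- move=> _ /imsetP[j jC ->]; rewrite ca ?(subsetP CF) //; have ujC : u j \in C by rewrite perm_closed.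
  by apply: contraNneq zC => /inj_a <- //; apply: (subsetP CF).
- by rewrite inE ca // eq_sym.
- by rewrite inE ca.
- rewrite disjoint_sym disjoints_subset; apply/subsetP => _ /imsetP[j jC ->].
  by rewrite !inE ca ?(subsetP CF) //; apply: contraNneq zC => <-.
Qed.

(** The candidates for x being the only loose column of S: the other last
    vertices are matched along u, while the partners of a x and of a (u x) lie
    in the columns required by u without being last vertices. *)
Definition one_loose S u x := [set m | [&& extends (a @: (S :\ x)) (fun v => a (u (c v))) m,
   m (a x) \in fiber (u x) :\ a (u x) & (m^-1)%g (a (u x)) \in fiber x :\ a x]].

Lemma card_one_loose S u x : S \subset F -> perm_on S u -> x \in S ->
  #|one_loose S u x| = (#|fiber (u x)|.-1 * #|fiber x|.-1 * (n - #|S|.+1)`!)%N.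
Proof.
move=> SF uS xS; have SxF : S :\ x \subset F by rewrite (subset_trans _ SF) ?subD1set.
have F_ j : j \in S -> j \in F by apply: (subsetP SF).
have anchor y : y \in F -> #|fiber y :\ a y| = #|fiber y|.-1.
  by move=> yF; rewrite [in RHS](cardsD1 (a y)) inE ca // eqxx.
rewrite -!anchor ?F_ ?perm_closed // [#|S|](cardsD1 x) xS add1n -card_anchors //.
apply: card_extensions_in2.
- move=> _ _ /imsetP[i iC ->] /imsetP[j jC ->]; move: iC jC => /setD1P[_ iS] /setD1P[_ jS].
  by rewrite !ca ?F_ // => /inj_a E; rewrite (perm_inj (E _ _)) // F_ // perm_closed.
- by apply/imsetP => -[j /setD1P[jx jS] /inj_a E]; rewrite E ?F_ ?eqxx // in jx.
- move=> _ /imsetP[j /setD1P[jx jS] ->]; rewrite !inE !ca ?F_ ?perm_closed //.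
  by rewrite (inj_eq perm_inj) (negbTE jx) andbF.
- move=> _ /imsetP[j /setD1P[jx jS] ->]; rewrite ca ?F_ //; apply: contra_neq jx => /inj_a E.
  by apply: (@perm_inj _ u); apply: E; rewrite F_ // perm_closed.
- by rewrite !inE eqxx.
- by rewrite !inE eqxx.
- rewrite disjoint_sym disjoints_subset; apply/subsetP => _ /imsetP[j /setD1P[jx jS] ->].
  by rewrite !inE ca ?F_ // (negbTE jx) andbF.
Qed.

Lemma tame_same_set0 S u m : S \subset F -> perm_on S u ->
  (m \in tame_set S S u) && (loose S S m == set0) = matched S m u.
Proof.
move=> SF uS; apply/andP/idP => [[mT /eqP L0]|mm].
  move: mT; rewrite inE => /and3P[hu _ _]; rewrite /matched uS; apply/forall_inP => j jS.
  by have [|_ _ ->] := tightP SF hu jS (_ : j \notin loose S S m); rewrite ?L0 ?inE.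
have L0 m' u' : matched S m' u' -> loose S S m' = set0.
  by move=> h; apply/eqP; rewrite -subset0 -(setDv S); apply: matched_loose h.
rewrite (L0 _ _ mm) eqxx inE /tame (L0 _ _ mm) (L0 _ _ (matchedV mm)) cards0 !andbT /=; split=> //.
by apply/andP; split; [apply: (matched_agrees (C := S))|apply: (matched_agrees (C := S))];
   rewrite ?matchedV // => x; rewrite setDv inE.
Qed.

Lemma tame_same_set1 S u m x : S \subset F -> perm_on S u ->
  (m \in tame_set S S u) && (loose S S m == [set x]) = (x \in S) && (m \in one_loose S u x).
Proof.
move=> SF uS; have F_ j : j \in S -> j \in F by apply: (subsetP SF).
apply/andP/andP => [[mT /eqP L1]|[xS]].
  have : x \in loose S S m by rewrite L1 inE.
  rewrite inE => /andP[xS xL]; split=> //.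
  move: mT; rewrite !inE => /and3P[hu /andP[_ /forall_inP hu'] _].
  have [_ /forall_inP uE] := andP hu; have uxS : u x \in S by rewrite perm_closed.
  apply/and3P; split.
  - apply/forall_inP => _ /imsetP[j /setD1P[jx jS] ->]; rewrite ca ?F_ //.
    by have [|_ _ ->] := tightP SF hu jS (_ : j \notin loose S S m); rewrite ?L1 ?inE.
  - rewrite (uE _ xS) andbT; apply: contraNneq xL => ->; exact: imset_f.
  - have := eqP (hu' _ uxS); rewrite /next_column permK => ->; rewrite eqxx andbT; apply: contraNneq xL => E.
    by rewrite -E permKV imset_f.
rewrite inE => /and3P[/forall_inP ext]; rewrite !inE => /andP[ne1 /eqP c1] /andP[ne2 /eqP c2].
have mE j : j \in S -> j != x -> m (a j) = a (u j).
  move=> jS jx; have jSx : j \in S :\ x by rewrite !inE jx jS.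
  by have /eqP := ext _ (imset_f a jSx); rewrite ca ?F_.
have mE' j : j \in S -> j != u x -> (m^-1)%g (a j) = a ((u^-1)%g j).
  move=> jS jx; rewrite -{1}(permKV u j) -mE ?permK ?perm_closed ?perm_onVE //.
  by apply: contra_neq jx => <-; rewrite permKV.
have L1 : loose S S m = [set x].
  apply/setP => j; rewrite !inE; case: (eqVneq j x) => [->|jx].
    rewrite xS /=; apply/imsetP => -[z zS E]; case/eqP: ne1.
    by rewrite E -c1 E ca ?F_.
  case jS: (j \in S) => //=; rewrite mE // imset_f //; by rewrite perm_closed.
have L2 : loose S S m^-1 \subset [set u x].
  apply/subsetP => j; rewrite !inE => /andP[jS]; apply: contraR => jx.
  by rewrite mE' // imset_f // perm_closed ?perm_onVE.
rewrite /tame L1 eqxx cards1 /= (leq_trans (subset_leq_card L2)) ?cards1 // andbT; split=> //.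
rewrite /agrees uS perm_onVE uS; apply/andP; split; apply/forall_inP => j jS; rewrite /next_column.
  by case: (eqVneq j x) => [->|jx]; [rewrite c1|rewrite mE // ca // F_ // perm_closed].
case: (eqVneq j (u x)) => [->|jx]; first by rewrite c2 permK.
by rewrite mE' // ca // F_ // perm_closed ?perm_onVE.
Qed.

Lemma card_tame_same S u : S \subset F -> perm_on S u ->
  #|tame_set S S u| = ((n - #|S|)`! +
     \sum_(x in S) #|fiber (u x)|.-1 * #|fiber x|.-1 * (n - #|S|.+1)`!)%N.
Proof.
move=> SF uS; rewrite -(card_anchors SF) -(card_extensions (inj_follow SF uS)) card_anchors //.
transitivity (\sum_m ((m \in tame_set S S u) && (loose S S m == set0) +
     \sum_x ((m \in tame_set S S u) && (loose S S m == [set x]))))%N.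
  rewrite -sum1_card big_mkcond; apply: eq_bigr => m _; case: ifPn => [mT|_]; last by rewrite big1.
  have [->|ne] := eqVneq (loose S S m) set0.
    by rewrite big1 // => x _; rewrite eqEcard cards1 cards0 andbF.
  have /cards1P[x ->] : #|loose S S m| == 1%N.
    by move: mT; rewrite inE => /and3P[_ _ /andP[L1 _]]; rewrite eqn_leq L1 card_gt0.
  rewrite (bigD1 x) //= eqxx big1 // => y yx.
  by rewrite (inj_eq set1_inj) eq_sym (negbTE yx).
rewrite big_split /=; congr addn.
  rewrite -sum1_card [RHS]big_mkcond; apply: eq_bigr => m _.
  by rewrite tame_same_set0 // matchedE // uS inE; case: (extends _ _ _).
rewrite exchange_big [RHS]big_mkcond; apply: eq_bigr => x _ /=.
under eq_bigr => m _ do rewrite tame_same_set1 //.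
case: ifPn => xS; last by rewrite big1.
by rewrite -card_one_loose // -sum1_card [RHS]big_mkcond; apply: eq_bigr => m _; case: (m \in _).
Qed.

Lemma card_perm_on_at S x z : x \in S -> z \in S ->
  (\sum_(u | perm_on S u && (u x == z)) 1 = #|S|.-1`!)%N.
Proof.
move=> xS zS; rewrite (cardsD1 x) xS -card_perm -sum1_card.
rewrite (reindex_inj (mulIg (tperm x z))); apply: eq_bigl => u /=.
rewrite permM (canF_eq (tpermK x z)) tpermR.
have tS : perm_on S (tperm x z).
  by apply/subsetP => j; rewrite !inE; case: tpermP => [->|->|]; rewrite ?eqxx.
apply/andP/idP => [[uS /eqP ux]|uS].
  have uS' : perm_on S u by rewrite -[u](mulgK (tperm x z)) tpermV; apply: perm_onM.
  apply/subsetP => j uj; rewrite !inE (subsetP uS') // andbT.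
  by apply: contraTneq uj => ->; rewrite !inE ux eqxx.
split; last by rewrite (out_perm uS) // !inE eqxx.
by apply: perm_onM tS; apply/subsetP => j /(subsetP uS)/setD1P[].
Qed.

Lemma sum_perm_on_prod S (d : I -> nat) :
  (\sum_(u | perm_on S u) \sum_(x in S) d (u x) * d x = #|S|.-1`! * (\sum_(x in S) d x) ^ 2)%N.
Proof.
rewrite exchange_big /= expnS expn1 [in RHS]big_distrl big_distrr /=; apply: eq_bigr => x xS.
rewrite (partition_big (fun u : {perm I} => u x) [in S]) => [|u uS] /=; last by rewrite perm_closed.
rewrite big_distrr /= big_distrr /=; apply: eq_bigr => z zS.
rewrite -(card_perm_on_at xS zS) big_distrl /=; apply: eq_bigr => u /andP[_ /eqP->].
by rewrite mul1n mulnC.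
Qed.

(** The first term counts the configurations without loose columns. The second
    has one loose column x in the first row and u x in the second; summing
    over u makes x and u x independent, which gives a square. *)
Lemma signed_sum_same S : S \subset F ->
  signed_sum S S = (#|S|`! * (n - #|S|)`! +
     #|S|.-1`! * (n - #|S|.+1)`! * (\sum_(x in S) #|fiber x|.-1) ^ 2)%N%:R.
Proof.
move=> SF; rewrite signed_sum_count //; congr _%:R.
transitivity (\sum_(u | perm_on S u) #|tame_set S S u|)%N.
  rewrite [RHS]big_mkcond; apply: eq_bigr => u _; case: ifPn => // uS.
  by apply/eqP; rewrite cards_eq0; apply/eqP/setP => m; rewrite !inE /agrees (negbTE uS).
rewrite (eq_bigr _ (fun u uS => card_tame_same SF uS)) big_split /= sum_nat_const card_perm.
congr addn; rewrite mulnAC -sum_perm_on_prod big_distrl /=; apply: eq_bigr => u _.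
by rewrite big_distrl.
Qed.
End Signed.

(** * Summation over pairs of nearly equal sets *)

Lemma sum_one_more (I : finType) (C F : {set I}) (H : {set I} -> rat) : C \subset F ->
  (forall S : {set I}, C \subset S -> S \subset F -> (1 < #|S :\: C|)%N -> H S = 0) ->
  \sum_(S : {set I} | (C \subset S) && (S \subset F)) H S = H C + \sum_(x in F :\: C) H (x |: C).
Proof.
move=> CF H0; rewrite (bigD1 C) ?subxx //=; congr (_ + _).
rewrite -(big_imset H (h := fun x => x |: C)) /=; last first.
  move=> x y /setDP[_ xC] /setDP[_ yC] E.
  by have := setU11 x C; rewrite E !inE (negbTE xC) orbF => /eqP.
rewrite [LHS](bigID [pred S | S \in [set x |: C | x in F :\: C]]) /= [X in _ + X]big1 ?addr0.
  apply: eq_bigl => S; case: imsetP => [[x /setDP[xF xC] ->]|_]; last by rewrite andbF.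
  rewrite andbT subsetUr subUset sub1set xF CF /=.
  by apply: contraNneq xC => <-; rewrite setU11.
move=> S /andP[/andP[/andP[CS SF] SC] /imsetP nS]; apply: H0 => //.
rewrite ltnNge; apply/negP => le1.
have /set0Pn[x xS] : S :\: C != set0.
  by apply: contra_neq SC => /eqP; rewrite setD_eq0 => SC; apply/eqP; rewrite eqEsubset SC.
case: nS; exists x; first by move: xS; rewrite !inE => /andP[->] /(subsetP SF).
have /eqP E : [set x] == S :\: C by rewrite eqEcard sub1set xS cards1.
rewrite E; apply/setP => y; rewrite !inE.
by case yC: (y \in C) => /=; rewrite ?orbF // (subsetP CS).
Qed.

(** Sort the pairs by the intersection C; in the terms that need not vanish,
    S1 and S2 have at most one element each outside C. *)
Lemma sum_near_pairs (I : finType) (F : {set I}) (G : {set I} -> {set I} -> rat) :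
  (forall S1 S2 : {set I}, S1 \subset F -> S2 \subset F ->
     (1 < #|S1 :\: S2|)%N || (1 < #|S2 :\: S1|)%N -> G S1 S2 = 0) ->
  \sum_(S1 : {set I} | S1 \subset F) \sum_(S2 : {set I} | S2 \subset F) G S1 S2 =
  \sum_(C : {set I} | C \subset F) (G C C + \sum_(x in F :\: C) (G (x |: C) C + G C (x |: C))
     + \sum_(x in F :\: C) \sum_(z in F :\: C | z != x) G (x |: C) (z |: C)).
Proof.
move=> G0; rewrite pair_big /=.
rewrite (partition_big (fun S => S.1 :&: S.2) [pred C : {set I} | C \subset F]) /=; last first.
  by move=> [S1 S2] /= /andP[S1F _]; apply: subset_trans S1F; apply: subsetIl.
apply: eq_bigr => C CF.
transitivity (\sum_(S1 : {set I} | (C \subset S1) && (S1 \subset F))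
   \sum_(S2 : {set I} | (C \subset S2) && (S2 \subset F) && (S1 :&: S2 == C)) G S1 S2).
  rewrite pair_big_dep /=; apply: eq_bigl => -[S1 S2] /=.
  case: eqP => [<-|_]; last by rewrite !andbF.
  by rewrite subsetIl subsetIr !andbT.
rewrite sum_one_more //; last first.
  move=> S CS SF lt; apply: big1 => T /andP[/andP[CT TF] /eqP E].
  by apply: G0; rewrite // -E setDIr setDv set0U in lt; rewrite lt.
have -> : \sum_(S2 : {set I} | (C \subset S2) && (S2 \subset F) && (C :&: S2 == C)) G C S2
   = G C C + \sum_(x in F :\: C) G C (x |: C).
  rewrite -sum_one_more //; last by move=> S CS SF lt; rewrite G0 ?lt ?orbT.
  by apply: eq_bigl => S; case CS: (C \subset S) => //=; rewrite (setIidPl CS) eqxx andbT.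
rewrite big_split /= -!addrA [X in _ = _ + X]addrCA; congr (_ + (_ + _)).
rewrite -big_split /=; apply: eq_bigr => x /setDP[xF xC].
have CFx : C \subset F :\ x by rewrite subsetD1 CF.
transitivity (\sum_(S2 : {set I} | (C \subset S2) && (S2 \subset F :\ x)) G (x |: C) S2).
  apply: eq_bigl => S; rewrite subsetD1 -!andbA; case CS: (C \subset S) => //=; congr (_ && _).
  apply/eqP/idP => [E|xS].
    by apply: contraNN xC => xS; rewrite -E !inE eqxx.
  apply/setP => y; rewrite !inE; case: eqP => [->|_]; first by rewrite (negbTE xS) (negbTE xC).
  by case yC: (y \in C) => //=; rewrite (subsetP CS).
rewrite sum_one_more //; last first.
  move=> S CS; rewrite subsetD1 => /andP[SF xS] lt; apply: G0; rewrite ?subUset ?sub1set ?xF //.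
  rewrite [X in _ || X](_ : _ = true) ?orbT // (leq_trans lt) // subset_leq_card //.
  apply/subsetP => y; rewrite !inE => /andP[yC yS]; rewrite yS andbT negb_or yC andbT.
  by apply: contraNneq xS => <-.
congr (_ + _); apply: eq_bigl => z; rewrite !inE.
by case: (z \in C); rewrite //= andbC.
Qed.

(** * Column functions and compositions *)

Section Profile.
Variables (s K : nat).
Implicit Types (c : {ffun 'I_s -> 'I_K}) (p : {ffun 'I_K -> 'I_s.+1}).

Definition monotone c := [forall v : 'I_s, forall w : 'I_s, (v <= w)%N ==> (c v <= c w)%N].

Definition profile c : {ffun 'I_K -> 'I_s.+1} := [ffun j => inord #|fiber c j|].

Lemma profileE c j : profile c j = #|fiber c j| :> nat.
Proof. by rewrite ffunE inordK // ltnS (leq_trans (max_card _)) ?card_ord. Qed.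

Lemma count_columns c j : count_mem j (codom c) = #|fiber c j|.
Proof.
rewrite count_map enumT cardE /enum_mem size_filter.
by apply: eq_count => v; rewrite /= inE.
Qed.

Definition le_ord : rel 'I_K := fun i j => (i <= j)%N.

Lemma le_ord_trans : transitive le_ord. Proof. by move=> y x z; apply: leq_trans. Qed.
Lemma le_ord_anti : antisymmetric le_ord.
Proof. by move=> x y; rewrite -eqn_leq => /eqP/val_inj. Qed.

(** Such a function is the sorted list of its columns with multiplicities, so
    it is determined by the multiplicities, and these are arbitrary. *)
Lemma monotone_sorted c : monotone c = sorted le_ord (codom c).
Proof.
rewrite (sorted_pairwise le_ord_trans) pairwise_map.
have ms : pairwise ltn [seq val v | v <- enum 'I_s].
  by rewrite val_enum_ord -sorted_pairwise ?iota_ltn_sorted //; apply: ltn_trans.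
apply/forallP/idP => [mc|pc v].
  move: ms; rewrite pairwise_map; apply: sub_pairwise => v w /= vw.
  by apply: (implyP (forallP (mc v) w)); apply: ltnW.
apply/forallP => w; apply/implyP; rewrite leq_eqVlt => /orP[/eqP/val_inj->//|vw].
have /(pairwiseP v)/(_ v w) := pc.
by rewrite !inE -cardE card_ord !nth_ord_enum; apply.
Qed.

Lemma profile_inj : {in monotone &, injective profile}.
Proof.
move=> c c'; rewrite ![_ \in monotone]monotone_sorted => sc sc' E.
have pE : codom c = codom c'.
  apply: (sorted_eq le_ord_trans le_ord_anti) => //.
  by apply/allP => j _ /=; rewrite !count_columns -!profileE E.
by apply/ffunP => v; have /eq_in_map/(_ v) := pE; apply; rewrite mem_enum.
Qed.

Lemma profile_sum c : (\sum_j profile c j = s)%N.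
Proof.
under eq_bigr => j _ do rewrite profileE -sum1_card.
rewrite -[RHS]card_ord -sum1_card (partition_big c predT) //=.
by apply: eq_bigr => j _; apply: eq_bigl => v; rewrite inE.
Qed.

Lemma profile_onto p : (\sum_j p j = s)%N -> exists2 c, monotone c & profile c = p.
Proof.
move=> ps; pose cols := flatten [seq nseq (p j) j | j <- enum 'I_K].
have sz : size cols = s.
  rewrite size_flatten /shape -map_comp sumnE big_map big_enum_cond /= -[RHS]ps.
  by apply: eq_bigr => j _; rewrite size_nseq.
have cnt j : count_mem j cols = p j.
  rewrite count_flatten -map_comp sumnE big_map big_enum_cond /= (bigD1 j) //=.
  rewrite count_nseq /= eqxx mul1n big1 ?addn0 // => i /negbTE ij.
  by rewrite count_nseq /= ij mul0n.
have srt : sorted le_ord cols.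
  rewrite (sorted_pairwise le_ord_trans) /cols.
  have : pairwise le_ord (enum 'I_K).
    have : pairwise leq [seq val v | v <- enum 'I_K].
      by rewrite val_enum_ord -sorted_pairwise ?iota_sorted //; apply: leq_trans.
    by rewrite pairwise_map.
  elim: (enum _) => //= j l IH /andP[jl /IH pl]; rewrite pairwise_cat pl andbT; apply/andP; split.
    apply/allrelP => x y /nseqP[-> _] /flattenP[_ /mapP[z zl ->] /nseqP[-> _]].
    exact: (allP jl).
  by elim: (p j : nat) => //= n ->; rewrite andbT; apply/allP => x /nseqP[-> _]; apply: leqnn.
pose t : s.-tuple 'I_K := Tuple (introT eqP sz); pose c := [ffun v => tnth t v].
have ct : codom c = cols.
  by rewrite -[RHS](map_tnth_enum t); apply: eq_map => v; rewrite ffunE.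
exists c; first by rewrite monotone_sorted ct.
by apply/ffunP => j; apply: val_inj; rewrite /= profileE -count_columns ct cnt.
Qed.

Lemma sum_monotone (T : {set 'I_K}) (G : {ffun 'I_K -> 'I_s.+1} -> rat) :
  \sum_(c | monotone c && (c @: setT \subset T)) G (profile c)
  = \sum_(p | comp_on set0 T p) G p.
Proof.
rewrite -(big_imset (A := [pred c | monotone c && (c @: setT \subset T)]) G) /=; last first.
  by move=> c c' /andP[mc _] /andP[mc' _]; apply: profile_inj.
apply: eq_bigl => p; rewrite /comp_on; apply/imsetP/andP => [[c /andP[mc cT] ->]|[/eqP ps /forallP pT]].
  rewrite profile_sum eqxx; split=> //; apply/forallP => j; rewrite inE /= profileE.
  apply/implyP => jT; rewrite cards_eq0; apply/eqP/setP => v; rewrite !inE.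
  by apply: contraNF jT => /eqP <-; apply: (subsetP cT); apply: imset_f.
have [c mc pc] := profile_onto ps; exists c => //; apply/andP; split=> //.
apply/subsetP => _ /imsetP[v _ ->]; have := pT (c v); rewrite inE /= -pc profileE.
by apply: contraTT => cvT; rewrite (negbTE cvT) /= cards_eq0; apply/set0Pn; exists v; rewrite inE.
Qed.
End Profile.

(** * Summation over column functions and marks *)

Lemma sum_subsets_bin (I : finType) (T : {set I}) (g : nat -> rat) :
  \sum_(C : {set I} | C \subset T) g #|C| = \sum_(h < #|T|.+1) 'C(#|T|, h)%:R * g h.
Proof.
have le (C : {set I}) : C \subset T -> (#|C| < #|T|.+1)%N by rewrite ltnS; apply: subset_leq_card.
rewrite (partition_big (fun C : {set I} => inord #|C| : 'I_#|T|.+1) predT) //=; apply: eq_bigr => h _.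
transitivity (\sum_(C in [set C : {set I} | C \subset T & #|C| == h]) g h).
  apply: eq_big => [C|C /andP[CT /eqP <-]]; last by rewrite inordK // le.
  rewrite inE; case CT: (C \subset T) => //=.
  by rewrite -(inj_eq val_inj) /= inordK // le.
by rewrite sumr_const cards_draws mulr_natl.
Qed.

Section Level.
Variables (I : finType) (s : nat) (T : {set I}) (w : nat -> nat -> nat).
Implicit Types (C : {set I}) (p : {ffun I -> 'I_s.+1}).

(** The number of admissible partners in column x: all vertices if x is
    outside C, all but the last one if x is in C. *)
Definition excess C p x := (p x - (x \in C))%N.

(** The contribution of the pairs (S1, S2) with intersection C for a given
    composition: in turn S1 = S2, one column more on one side, and one column
    more on either side. *)
Definition set_weight C p : rat :=
  let h := #|C| in
  (w h h * (h`! * (s - h)`! + h.-1`! * (s - h.+1)`! * (\sum_(x in C) excess C p x) ^ 2))%N%:R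
  - ((w h.+1 h + w h h.+1) * (h`! * (s - h.+1)`! * \sum_(x in T :\: C) excess C p x))%N%:R
  + (w h.+1 h.+1 * (h`! * (s - h.+2)`! *
       \sum_(x in T :\: C) \sum_(z in T :\: C | z != x) excess C p x * excess C p z))%N%:R.

(** Every sum over columns is a sum of first or second moments of p with
    values depending on cardinalities only. *)
Lemma sum_set_weight C : C \subset T ->
  \sum_(p : {ffun I -> 'I_s.+1} | comp_on C T p) set_weight C p
  = level_weight s #|T| #|C| w.
Proof.
move=> CT; have TC x : x \in C -> x \in T by apply: (subsetP CT).
have cTC : #|T :\: C| = (#|T| - #|C|)%N by rewrite cardsD (setIidPr CT).
have m1 x : x \in T -> (\sum_(p | comp_on C T p) excess C p x = negbin_coef #|C|.+1 #|T|.+1 s)%N.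
  exact: comp_moment1.
have m2 x z : x \in T -> z \in T -> z != x ->
    (\sum_(p | comp_on C T p) excess C p x * excess C p z = negbin_coef #|C|.+2 #|T|.+2 s)%N.
  by move=> xT zT; rewrite comp_moment2 // eq_sym => /negbTE->; rewrite mul1n mul0n addn0.
have m3 x : x \in T ->
    (\sum_(p | comp_on C T p) excess C p x * excess C p x = 2 * negbin_coef #|C|.+2 #|T|.+2 s + negbin_coef #|C|.+1 #|T|.+1 s)%N.
  by move=> xT; rewrite comp_moment2 // eqxx mul1n.
rewrite /set_weight big_split sumrB -!natr_sum /=.
congr (_%:R - _%:R + _%:R); rewrite -big_distrr; congr (_ * _)%N.
- rewrite big_split /=; congr addn.
    by rewrite sum_nat_const -(comp_moment0 s CT) -sum1_card mulnC.
  rewrite -big_distrr; congr muln; under eq_bigr => p _ do rewrite expnS expn1 big_distrlr /=.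
  rewrite exchange_big /=.
  transitivity (\sum_(x in C) (#|C|.+1 * negbin_coef #|C|.+2 #|T|.+2 s + negbin_coef #|C|.+1 #|T|.+1 s))%N.
    apply: eq_bigr => x xC; rewrite exchange_big /= (bigD1 x) //= m3 ?TC //.
    rewrite (eq_bigr (fun=> negbin_coef #|C|.+2 #|T|.+2 s)) => [|z /andP[zC zx]]; last by rewrite m2 ?TC.
    rewrite sum_nat_const.
    have -> : #|[pred z in C | z != x]| = #|C|.-1.
      by rewrite (cardsD1 x C) xC; apply: eq_card => z; rewrite !inE andbC.
    have: (0 < #|C|)%N by apply/card_gt0P; exists x.
    case: #|C| => // h _; move: (negbin_coef _ _ _) (negbin_coef _ _ _) => a b /=; ring.
  by rewrite sum_nat_const; ring.
- rewrite -big_distrr exchange_big /= (eq_bigr (fun=> negbin_coef #|C|.+1 #|T|.+1 s)); last first.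
    by move=> x /setDP[xT _]; rewrite m1.
  by rewrite sum_nat_const cTC; ring.
- rewrite -big_distrr exchange_big /=.
  rewrite (eq_bigr (fun=> #|T :\: C|.-1 * negbin_coef #|C|.+2 #|T|.+2 s)%N); last first.
    move=> x xTC; rewrite exchange_big /=.
    rewrite (eq_bigr (fun=> negbin_coef #|C|.+2 #|T|.+2 s)) => [|z /andP[/setDP[zT _] zx]].
      rewrite sum_nat_const; congr muln; rewrite (cardsD1 x) xTC.
      by apply: eq_card => z; rewrite [RHS]in_setD1 andbC.
    by rewrite m2 //; case/setDP: xTC.
  by rewrite sum_nat_const cTC -subn1 -subnDA addn1; ring.
Qed.

End Level.

Section Anchors.
Variables (s K : nat) (v0 : 'I_s) (c : {ffun 'I_s -> 'I_K}).

(** The default v0 is the value at columns that are not occupied. *)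
Definition anchor (j : 'I_K) : 'I_s := last v0 [seq v <- enum 'I_s | c v == j].

Definition columns : {set 'I_K} := c @: setT.

Lemma anchorK : {in columns, cancel anchor c}.
Proof.
move=> _ /imsetP[v _ ->]; rewrite /anchor; set l := filter _ _.
have vl : v \in l by rewrite mem_filter eqxx mem_enum.
have /= : last v0 l \in l by case: l vl => //= x l _; apply: mem_last.
by rewrite mem_filter => /andP[/eqP].
Qed.

Local Notation a := anchor.
Local Notation F := columns.

Lemma sum_columns_ext (T C : {set 'I_K}) (g : 'I_K -> nat) : F \subset T ->
  (forall x, x \notin F -> g x = 0%N) -> (\sum_(x in F :\: C) g x = \sum_(x in T :\: C) g x)%N.
Proof.
move=> FT g0; rewrite [RHS](bigID [in F]) /= [X in (_ + X)%N]big1 ?addn0.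
  apply: eq_bigl => x; rewrite !inE; case: (x \in C) => //=.
  by case xF: (x \in F); rewrite ?andbF // (subsetP FT).
by move=> x /andP[_ /g0].
Qed.

(** Signed sums of sets that differ by two or more columns in one direction
    vanish, so [sum_near_pairs] applies. Columns of T that are not occupied
    have excess 0 and may be included in the sums. *)
Lemma sum_signed_sums (T : {set 'I_K}) (w : nat -> nat -> nat) : F \subset T ->
  \sum_(S1 : {set 'I_K} | S1 \subset F) \sum_(S2 : {set 'I_K} | S2 \subset F)
     (w #|S1| #|S2|)%:R * ((-1) ^+ #|S1| * (-1) ^+ #|S2| * signed_sum c a S1 S2)
  = \sum_(C : {set 'I_K} | C \subset F) set_weight T w C (profile c).
Proof.
move=> FT; rewrite sum_near_pairs => [|S1 S2 S1F S2F]; last first.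
  case/orP=> lt; last rewrite signed_sumC; rewrite (signed_sum_far anchorK) ?mulr0 //.
apply: eq_bigr => C CF.
have ex x : x \notin C -> excess C (profile c) x = #|fiber c x|.
  by move=> xC; rewrite /excess (negbTE xC) subn0 profileE.
have f0 x : x \notin F -> #|fiber c x| = 0%N.
  move=> xF; apply/eqP; rewrite cards_eq0; apply/eqP/setP => v; rewrite !inE.
  by apply: contraNF xF => /eqP <-; apply: imset_f.
have inF x : x \in F :\: C -> [/\ x \in F, x \notin C & #|x |: C| = #|C|.+1].
  by case/setDP=> xF xC; rewrite cardsU1 xC.
rewrite /set_weight; congr (_ + _ + _).
- rewrite (signed_sum_same anchorK CF) card_ord -expr2 sqrr_sign mul1r -natrM.
  congr (_ * (_ + _ * _ ^ 2))%:R; apply: eq_bigr => x xC.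
  by rewrite /excess xC profileE subn1.
- rewrite -(@sum_columns_ext T C) //; last first.
    by move=> x xF; rewrite /excess profileE f0.
  rewrite !big_distrr /= natr_sum -sumrN; apply: eq_bigr => x xFC.
  have [xF xC ->] := inF x xFC; rewrite ex // [signed_sum c a C _]signed_sumC.
  rewrite (signed_sum_one anchorK CF xF xC) card_ord.
  have e1 : (-1) ^+ #|C|.+1 * (-1) ^+ #|C| = -1 :> rat.
    by rewrite exprS -mulrA -expr2 sqrr_sign mulr1.
  rewrite [(-1) ^+ #|C| * _]mulrC e1 mulN1r !mulrN -opprD -mulrDl -natrD -natrM.
  by congr (- _%:R); rewrite [(#|fiber c x| * _)%N]mulnC !mulnA.
- rewrite -(@sum_columns_ext T C) //; last first.
    by move=> x xF; rewrite big1 // => z _; rewrite /excess profileE f0.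
  rewrite !big_distrr /= natr_sum; apply: eq_bigr => x xFC; have [xF xC cx] := inF x xFC.
  have E : forall g : 'I_K -> nat, (forall z, z \notin F -> g z = 0%N) ->
      (\sum_(z in T :\: C | z != x) g z = \sum_(z in F :\: C | z != x) g z)%N.
    move=> g g0; rewrite 2!big_mkcondr /= -(@sum_columns_ext T C) // => z zF.
    by rewrite g0 // if_same.
  rewrite E => [|z zF]; last by rewrite [excess C _ z]/excess profileE f0 // muln0.
  rewrite !big_distrr /= natr_sum; apply: eq_bigr => z /andP[zFC zx].
  have [zF zC ->] := inF z zFC; rewrite cx !ex // -expr2 sqrr_sign mul1r.
  rewrite (signed_sum_two anchorK CF xF zF xC zC) 1?eq_sym // card_ord -natrM.
  by congr _%:R; ring.
Qed.
End Anchors.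

Section Total.
Variables (s K : nat) (v0 : 'I_s).
Implicit Types (c : {ffun 'I_s -> 'I_K}) (R S T : {set 'I_K}) (m : 'S_s).

Definition rooted c R m :=
  [forall j in columns c :\: R, escapes (next_column c (anchor v0 c) m) (columns c :\: R) j].

Lemma count_rooted c R1 R2 :
  \sum_m (rooted c R1 m && rooted c R2 m^-1)%:R
  = \sum_(S1 : {set 'I_K} | S1 \subset columns c :\: R1)
      \sum_(S2 : {set 'I_K} | S2 \subset columns c :\: R2)
      (-1) ^+ #|S1| * (-1) ^+ #|S2| * signed_sum c (anchor v0 c) S1 S2.
Proof.
set a := anchor v0 c.
transitivity (\sum_(S1 : {set 'I_K} | S1 \subset columns c :\: R1)
      \sum_(S2 : {set 'I_K} | S2 \subset columns c :\: R2) \sum_m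
      ((\sum_(u | agrees (next_column c a m) S1 u) (-1) ^+ #|S1| * (-1) ^+ u) *
       (\sum_(u | agrees (next_column c a m^-1) S2 u) (-1) ^+ #|S2| * (-1) ^+ u)) : rat).
  under eq_bigr => m _ do rewrite -mulnb natrM /rooted -!signed_forest_sum big_distrlr /=.
  by rewrite exchange_big /=; apply: eq_bigr => S1 _; rewrite exchange_big.
apply: eq_bigr => S1 _; apply: eq_bigr => S2 _.
rewrite /signed_sum big_distrr /=.
rewrite (eq_bigl (fun t => agrees (next_column c a t.1) S1 t.2.1 && agrees (next_column c a t.1^-1) S2 t.2.2)) //.
rewrite -(pair_big_dep predT (fun m u => agrees (next_column c a m) S1 u.1 && agrees (next_column c a m^-1) S2 u.2)
   (fun m u => (-1) ^+ #|S1| * (-1) ^+ #|S2| * config_sign (m, u))) /=.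
apply: eq_bigr => m _; rewrite big_distrlr pair_big /=; apply: eq_bigr => -[u u'] _.
by rewrite /config_sign mulrACA.
Qed.

Lemma card_avoiding T S r : S \subset T ->
  (\sum_(R : {set 'I_K} | [&& R \subset T, #|R| == r & [disjoint R & S]]) 1 = 'C(#|T| - #|S|, r))%N.
Proof.
move=> ST; have <- : #|T :\: S| = (#|T| - #|S|)%N by rewrite cardsD (setIidPr ST).
rewrite -cards_draws -sum1_card; apply: eq_bigl => R.
by rewrite inE subsetD -andbA; congr (_ && _); rewrite andbC.
Qed.

Definition within_sum r1 r2 T : rat :=
  \sum_(c | monotone c && (columns c \subset T))
   \sum_(R1 : {set 'I_K} | (R1 \subset T) && (#|R1| == r1))
    \sum_(R2 : {set 'I_K} | (R2 \subset T) && (#|R2| == r2))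
     \sum_m (rooted c R1 m && rooted c R2 m^-1)%:R.

(** Exchange the sums over marks and over S1 and S2: the number of sets of
    marks disjoint from S1 depends on the size of S1 only. What remains
    depends on c through its profile, so [sum_monotone] and [sum_set_weight]
    apply. *)
Lemma within_sumE r1 r2 T : (0 < s)%N ->
  within_sum r1.+1 r2.+1 T = (within_count s r1 r2 #|T|)%:R.
Proof.
move=> s0; pose w a b := ('C(#|T| - a, r1.+1) * 'C(#|T| - b, r2.+1))%N.
rewrite /within_count -sum_level_weight // -/w.
transitivity (\sum_(c : {ffun 'I_s -> 'I_K} | monotone c && (columns c \subset T))
   \sum_(C : {set 'I_K} | C \subset columns c) set_weight T w C (profile c)).
  apply: eq_bigr => c /andP[_ FT]; rewrite -(sum_signed_sums v0) //.
  under eq_bigr => R1 _ do under eq_bigr => R2 _ do rewrite count_rooted.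
  set G := fun S1 S2 : {set 'I_K} => (-1) ^+ #|S1| * (-1) ^+ #|S2| * signed_sum c (anchor v0 c) S1 S2.
  transitivity (\sum_(R1 : {set 'I_K} | (R1 \subset T) && (#|R1| == r1.+1))
    \sum_(S1 : {set 'I_K} | S1 \subset columns c :\: R1)
    \sum_(R2 : {set 'I_K} | (R2 \subset T) && (#|R2| == r2.+1))
    \sum_(S2 : {set 'I_K} | S2 \subset columns c :\: R2) G S1 S2).
    by apply: eq_bigr => R1 _; rewrite exchange_big.
  rewrite (exchange_big_dep (fun S1 : {set 'I_K} => S1 \subset columns c)) /=; last first.
    by move=> R1 S1 _; rewrite subsetD => /andP[].
  apply: eq_bigr => S1 S1F.
  rewrite (eq_bigl (fun R : {set 'I_K} => [&& R \subset T, #|R| == r1.+1 & [disjoint R & S1]])); last first.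
    by move=> R; rewrite subsetD S1F /= disjoint_sym -andbA.
  rewrite sumr_const -sum1_card card_avoiding ?(subset_trans S1F) //.
  rewrite (exchange_big_dep (fun S2 : {set 'I_K} => S2 \subset columns c)) /=; last first.
    by move=> R2 S2 _; rewrite subsetD => /andP[].
  rewrite -sumrMnl; apply: eq_bigr => S2 S2F.
  rewrite (eq_bigl (fun R : {set 'I_K} => [&& R \subset T, #|R| == r2.+1 & [disjoint R & S2]])); last first.
    by move=> R; rewrite subsetD S2F /= disjoint_sym -andbA.
  rewrite sumr_const -sum1_card card_avoiding ?(subset_trans S2F) //.
  by rewrite -/(G S1 S2) mulr_natl -mulrnA mulnC.
pose occ (p : {ffun 'I_K -> 'I_s.+1}) : {set 'I_K} := [set j | 0 < p j]%N.
have colE c : columns c = occ (profile c).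
  apply/setP => j; rewrite inE profileE card_gt0; apply/imsetP/set0Pn => [[v _ ->]|[v]].
    by exists v; rewrite inE.
  by rewrite inE => /eqP <-; exists v.
under eq_bigr => c _ do rewrite colE.
rewrite (sum_monotone T (fun p => \sum_(C : {set 'I_K} | C \subset occ p) set_weight T w C p)).
rewrite (exchange_big_dep (fun C : {set 'I_K} => C \subset T)) /=; last first.
  move=> p C /andP[_ /forallP pT] /subsetP Cp; apply/subsetP => j /Cp; rewrite inE => pj.
  by have := pT j; rewrite inE /=; case: (j \in T) => //= /eqP E; rewrite E in pj.
rewrite -(sum_subsets_bin T (fun h => level_weight s #|T| h w)); apply: eq_bigr => C CT.
rewrite -(sum_set_weight s w CT).
apply: eq_bigl => p; rewrite /comp_on -andbA; congr (_ && _).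
apply/andP/forallP => [[/forallP h0 /subsetP Cp] j|h].
  have := h0 j; rewrite inE /= => ->; rewrite andbT; apply/implyP => /Cp; by rewrite inE.
split; first by apply/forallP => j; have /andP[_ ->] := h j; rewrite inE.
by apply/subsetP => j jC; rewrite inE; have := h j; rewrite jC => /andP[].
Qed.
End Total.

(** * Vertical arrays and their supports *)

Section Exact.
Variables (s K r1 r2 : nat) (v0 : 'I_s).

(** A balanced array without the redundant second column function: the column
    function, the marks of row 1, the marks of row 2 and the matching. *)
Definition skeleton : finType :=
  ({ffun 'I_s -> 'I_K} * ({set 'I_K} * ({set 'I_K} * 'S_s)))%type.

Definition sk_proper (R1 R2 : nat) (t : skeleton) :=
  let: (c, (M1, (M2, m))) := t in
  [&& monotone c, #|M1| == R1, #|M2| == R2, rooted v0 c M1 m & rooted v0 c M2 m^-1].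

Definition sk_support (t : skeleton) := columns t.1 :|: t.2.1 :|: t.2.2.1.

Lemma card_sk_within (T : {set 'I_K}) : (0 < s)%N ->
  #|[set t | sk_proper r1.+1 r2.+1 t & sk_support t \subset T]|%:R = (within_count s r1 r2 #|T|)%:R :> rat.
Proof.
move=> s0; rewrite -(within_sumE v0 r1 r2 T s0) /within_sum -sum1_card natr_sum.
pose P (M : {set 'I_K}) r := (M \subset T) && (#|M| == r).
pose Q (c : {ffun 'I_s -> 'I_K}) M1 M2 (m : 'S_s) := rooted v0 c M1 m && rooted v0 c M2 m^-1.
rewrite (eq_bigl (fun t : skeleton => (monotone t.1 && (columns t.1 \subset T)) &&
   (P t.2.1 r1.+1 && (P t.2.2.1 r2.+1 && Q t.1 t.2.1 t.2.2.1 t.2.2.2)))); last first.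
  case=> c [M1 [M2 m]]; rewrite inE /= /sk_support /= !subUset /P /Q.
  apply/andP/andP => [[/and5P[-> -> -> -> ->] /andP[/andP[-> ->] ->]] //|].
  by case=> /andP[-> ->] /and3P[/andP[-> ->] /andP[-> ->] /andP[-> ->]].
rewrite -(pair_big_dep (fun c : {ffun 'I_s -> 'I_K} => monotone c && (columns c \subset T))
   (fun c q => P q.1 r1.+1 && (P q.2.1 r2.+1 && Q c q.1 q.2.1 q.2.2)) (fun _ _ => 1)) /=.
apply: eq_bigr => c _.
rewrite -(pair_big_dep (fun M1 => P M1 r1.+1)
   (fun M1 q => P q.1 r2.+1 && Q c M1 q.1 q.2) (fun _ _ => 1)) /=.
apply: eq_bigr => M1 _.
rewrite -(pair_big_dep (fun M2 => P M2 r2.+1) (fun M2 m => Q c M1 M2 m) (fun _ _ => 1)) /=.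
apply: eq_bigr => M2 _; rewrite big_mkcond; apply: eq_bigr => m _.
by rewrite /Q; case: (_ && _).
Qed.

(** Induction on the size of T: summed over the subsets of T, both sides give
    [within_count]. *)
Lemma card_sk_exact (T : {set 'I_K}) : (0 < s)%N ->
  #|[set t | sk_proper r1.+1 r2.+1 t & sk_support t == T]|%:R = support_formula s r1 r2 #|T|.
Proof.
move=> s0; have [n] := ubnP #|T|; elim: n T => // n IH T; rewrite ltnS => Tn.
have : \sum_(T' : {set 'I_K} | T' \subset T) #|[set t | sk_proper r1.+1 r2.+1 t & sk_support t == T']|%:R
     = \sum_(T' : {set 'I_K} | T' \subset T) support_formula s r1 r2 #|T'|.
  rewrite sum_subsets_bin sum_support_formula // -card_sk_within // -natr_sum; congr _%:R.
  rewrite -[RHS]sum1_card (partition_big sk_support (fun T' => T' \subset T)) /=; last first.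
    by move=> t; rewrite inE => /andP[].
  apply: eq_bigr => T' T'T; rewrite -sum1_card; apply: eq_bigl => t; rewrite !inE.
  by case: eqP => [->|_]; rewrite ?T'T ?andbT ?andbF.
rewrite (bigD1 T) //= [RHS](bigD1 T) //=.
have -> : \sum_(T' : {set 'I_K} | (T' \subset T) && (T' != T))
     #|[set t | sk_proper r1.+1 r2.+1 t & sk_support t == T']|%:R
   = \sum_(T' : {set 'I_K} | (T' \subset T) && (T' != T)) support_formula s r1 r2 #|T'|.
  apply: eq_bigr => T' /andP[T'T ne]; apply: IH; apply: leq_trans Tn; apply: proper_card.
  by rewrite properEneq ne.
exact: addIr.
Qed.
End Exact.

Section Arrays.
Variables (K R1 R2 s : nat) (v0 : 'I_s).
Implicit Type A : varray K R1 R2 s.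

Definition row_columns A i : {ffun 'I_s -> 'I_K} := (vdata A).1.1 i.

Lemma anchor_cell A i j : anchor v0 (row_columns A i) j = last v0 (cell A i j).
Proof. by []. Qed.

Lemma size_cell A i j : size (cell A i j) = #|fiber (row_columns A i) j|.
Proof.
rewrite size_filter enumT cardE /enum_mem size_filter.
by apply: eq_count => v; rewrite /= inE.
Qed.

Lemma occupiedE A i : occupied A i = columns (row_columns A i).
Proof.
apply/setP => j; rewrite inE -size_eq0 size_cell -lt0n card_gt0.
apply/set0Pn/imsetP => [[v]|[v _ ->]]; first by rewrite inE => /eqP<-; exists v.
by exists v; rewrite inE.
Qed.

Lemma row_monotone A i : monotone (row_columns A i).
Proof.
case: A => d wf; case/and3P: (wf) => /forallP/(_ i) h _ _; rewrite /monotone.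
exact: h.
Qed.

(** Both column functions are weakly increasing, hence determined by their
    profiles. *)
Lemma balanced_columns A : balance_condition A = (row_columns A false == row_columns A true).
Proof.
apply/forallP/eqP => [bal|E j]; last by rewrite !size_cell E.
apply: profile_inj; [exact: row_monotone|exact: row_monotone|].
apply/ffunP => j; apply: val_inj; rewrite /= !profileE -!size_cell; exact/eqP.
Qed.

Definition row_matching A (i : bool) : 'S_s := if i then ((vdata A).2^-1)%g else (vdata A).2.

Lemma psiE A i k l : row_columns A false = row_columns A true ->
  let c := row_columns A i in
  (psi A i k == Some l) = (k \in columns c :\: marked A i) &&
                          (next_column c (anchor v0 c) (row_matching A i) k == l).
Proof.
move=> E c; rewrite inE -occupiedE inE /psi; case: ifP => //= _.
rewrite /next_column {2}/c anchor_cell; case: (cell A i k) => //= v q.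
have -> : vcol A (~~ i) (partner A i (last v q)) = c (row_matching A i (last v q)).
  by rewrite /c /vcol /partner /row_matching; case: i {c} => /=; rewrite -/(row_columns A _) E.
by [].
Qed.

(** A non-trivial path of psi ends in an occupied column, so a path that
    leaves the unmarked occupied columns has reached a mark. *)
Lemma forest_row A i : row_columns A false = row_columns A true ->
  [forall j in occupied A i :\: marked A i,
     [exists r in marked A i, connect [rel k l | psi A i k == Some l] j r]]
  = rooted v0 (row_columns A i) (marked A i) (row_matching A i).
Proof.
move=> E; rewrite /rooted occupiedE; set c := row_columns A i; set R := marked A i.
set f := next_column _ _ _; set D := columns c :\: R.
have cE : connect [rel k l | psi A i k == Some l] =2 connect (step f D).
  by apply: eq_connect => k l; rewrite /= psiE.
apply: eq_forallb => j; case jD: (j \in D) => //=; apply: eq_existsb => r; rewrite cE.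
case jr: (connect _ j r); rewrite ?andbF // !andbT.
rewrite inE; case rR: (r \in R) => //=.
have -> : r \in columns c; last by [].
move/connectP: jr => [p]; case/lastP: p => [_ /= ->|p x]; first by move: jD; rewrite inE => /andP[].
rewrite rcons_path last_rcons => /andP[_ /andP[_ /eqP <-]] ->.
by apply: imset_f.
Qed.

Definition skeleton_of A : skeleton s K :=
  (row_columns A false, (marked A false, (marked A true, (vdata A).2))).

Lemma nonempty_support A : row_columns A false = row_columns A true ->
  nonempty_condition A = (sk_support (skeleton_of A) == setT).
Proof.
move=> E; rewrite -subTset /sk_support /=.
have occ i j : (cell A i j != [::]) = (j \in columns (row_columns A false)).
  by have /setP/(_ j) := occupiedE A i; rewrite inE => ->; case: i; rewrite ?E.
apply/forallP/subsetP => [ne j _|sub j].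
  have /existsP[[]] := ne j; rewrite occ !inE => /orP[->|->]; rewrite ?orbT //.
have := sub j (in_setT j); rewrite !inE => /orP[/orP[jc|jm]|jm]; apply/existsP.
- by exists false; rewrite occ jc.
- by exists false; rewrite jm orbT.
- by exists true; rewrite jm orbT.
Qed.

Lemma properb_skeleton A :
  properb A = (row_columns A false == row_columns A true)
    && (sk_proper v0 R1 R2 (skeleton_of A) && (sk_support (skeleton_of A) == setT)).
Proof.
rewrite /properb balanced_columns andbCA; case: eqP => //= E.
rewrite nonempty_support // andbC; congr (_ && _).
have /and3P[_ /eqP c1 /eqP c2] : varray_wf R1 R2 (vdata A) by case: (A).
rewrite row_monotone c1 c2 !eqxx /=.
have fr i := forest_row i E.
rewrite -[rooted v0 _ (marked A false) _]/(rooted v0 _ (marked A false) (row_matching A false)).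
rewrite {2}E -[rooted v0 _ (marked A true) _]/(rooted v0 _ (marked A true) (row_matching A true)).
rewrite -!fr; apply/forallP/andP => [h|[h1 h2] [] //]; by split; apply: h.
Qed.

Lemma num_proper_skeleton : num_proper K R1 R2 s =
  #|[set t : skeleton s K | sk_proper v0 R1 R2 t & sk_support t == setT]|.
Proof.
rewrite /num_proper -(card_in_imset (f := skeleton_of)); last first.
  move=> A A'; rewrite !inE !properb_skeleton => /andP[/eqP E _] /andP[/eqP E' _].
  case=> ec e1 e2 em; apply: val_inj => /=.
  move: E E' ec e1 e2 em; rewrite /row_columns /marked.
  case: (vdata A) (vdata A') => [[cc M] m] [[cc' M'] m'] /= E E' ec e1 e2 ->.
  congr (_, _, _); apply/ffunP => -[] //.
  by rewrite -E -E'.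
apply: eq_card => t; rewrite [RHS]inE; apply/imsetP/idP => [[A]|].
  by rewrite inE properb_skeleton => /andP[_ h] ->.
case: t => c [M1 [M2 m]] /andP[ok full].
pose d : varray_data K s := ([ffun=> c], [ffun i : bool => if i then M2 else M1], m).
have wf : varray_wf R1 R2 d.
  move: ok => /and5P[mc /eqP c1 /eqP c2 _ _]; apply/and3P; rewrite !ffunE c1 c2 !eqxx; split=> //.
  by apply/forallP => i; rewrite ffunE.
have E : skeleton_of (VArray wf) = (c, (M1, (M2, m))).
  by rewrite /skeleton_of /row_columns /marked /= !ffunE.
exists (VArray wf) => //; rewrite inE properb_skeleton E ok full !andbT.
by rewrite /row_columns /= !ffunE.
Qed.
End Arrays.

Unset Implicit Arguments.

Theorem theorem23 (s K R1 R2 : nat)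
    (hs : (1 <= s)%N) (hK : (1 <= K)%N) (hR1 : (1 <= R1)%N) (hR2 : (1 <= R2)%N) :
  (num_proper K R1 R2 s)%:R =
    ((s + R1 - 1)`! * (s + R2 - 1)`!)%N%:R / ((s + R1 + R2 - 2)`!)%:R
    * 'C(s + R1 + R2 - 2, K - 1)%:R
    * (('C(K - 1, R1 - 1) * 'C(K - 1, R2 - 1))%N%:R
       - ('C(K - 1, s + R1 - 1) * 'C(K - 1, s + R2 - 1))%N%:R) :> rat.
Proof.
case: R1 R2 K hR1 hR2 hK => [//|r1] [//|r2] [//|j] _ _ _.
have v0 : 'I_s := Ordinal hs.
rewrite (num_proper_skeleton _ _ _ v0) card_sk_exact // cardsT card_ord /= /proper_formula.
have -> : (s + r1.+1 - 1 = s + r1)%N by lia.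
have -> : (s + r2.+1 - 1 = s + r2)%N by lia.
have -> : (s + r1.+1 + r2.+1 - 2 = s + r1 + r2)%N by lia.
by rewrite !subn1.
Qed.
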